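(* Let $f_{1}=t^{2}+2^{5}$, $g_{1}=-2^{4}t$ and $h_{1}=-(t^{2}-2^{5})$ be polynomials in $\mathbb{Q}[t]$, and define the set of triples of rational numbers $$S=\left\{\left(f_{1}\Big(\tfrac{-2^4 t}{-10+t^2}\Big),\ g_{1}\Big(\tfrac{-2^4 t}{-10+t^2}\Big),\ h_{1}\Big(\tfrac{-2^4 t}{-10+t^2}\Big)\right):t\in\mathbb{Q}^{\times}\right\}.$$ There exists a finite subset $S_{0}\subset S$ such that for all $(a,b,c)\in S\setminus S_{0}$ the curve $$E_{a,b,c}: y^2 = x(x+2a^2)(x-b^2)$$ is elliptic and the rank of the group $E_{a,b,c}(\mathbb{Q})$ is at least $3$.
   Context: Every triple $(a,b,c)\in S$ satisfies $-2a^2+b^2=-2c^2$. *)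

(* Defs.v *)
From HB Require Import structures.
From mathcomp Require Import all_boot all_order all_algebra all_field.
From mathcomp Require Import boolp classical_sets cardinality.

Set Implicit Arguments.
Unset Strict Implicit.
Unset Printing Implicit Defensive.

Import GRing.Theory Num.Theory.
Local Open Scope classical_set_scope.
Local Open Scope ring_scope.

(* A polynomial [p], in practice a monic cubic, stands for the curve
   y^2 = p(x) over Q. *)

(* Smoothness is tested at the points over the algebraic closure [algC] of Q,
   where the partial derivatives of y^2 - p(x) are 2y and - p'(x).  Only affine
   points need be tested: the unique point at infinity [0 : 1 : 0] of a
   Weierstrass cubic is never singular. *)
Definition smooth_curve (p : {poly rat}) : Prop :=
  forall x y : algC,
    y ^+ 2 = (map_poly ratr p).[x] ->
    ~ (2 * y = 0 /\ (map_poly ratr p)^`().[x] = 0).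

Definition elliptic (p : {poly rat}) : Prop :=
  [/\ p \is monic, size p = 4%N & smooth_curve p].

(* [None] is the point at infinity. *)
Definition point : Type := option (rat * rat).

Definition on_curve (p : {poly rat}) (P : point) : Prop :=
  if P is Some (x, y) then y ^+ 2 = p.[x] else True.

Definition pt_opp (P : point) : point :=
  if P is Some (x, y) then Some (x, - y) else None.

(* Chord-tangent law.  A line of slope l meets y^2 = p(x) in three points whose
   abscissas sum to l^2 - p`_2. *)
Definition pt_add (p : {poly rat}) (P Q : point) : point :=
  match P, Q with
  | None, _ => Q
  | _, None => P
  | Some (x1, y1), Some (x2, y2) =>
      if (x1 == x2) && (y1 == - y2) then None
      else
        let l := if x1 == x2 then p^`().[x1] / (2 * y1)
                 else (y2 - y1) / (x2 - x1) in
        let x3 := l ^+ 2 - p`_2 - x1 - x2 in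
        Some (x3, - (y1 + l * (x3 - x1)))
  end.

Definition pt_mulz (p : {poly rat}) (n : int) (P : point) : point :=
  match n with
  | Posz m => iter m (pt_add p P) None
  | Negz m => pt_opp (iter m.+1 (pt_add p P) None)
  end.

(* The rank of an abelian group is the maximal number of Z-linearly independent
   elements. *)
Definition rank_at_least (p : {poly rat}) (r : nat) : Prop :=
  exists P : 'I_r -> point,
    (forall i, on_curve p (P i)) /\
    (forall n : 'I_r -> int,
        \big[pt_add p/None]_(i < r) pt_mulz p (n i) (P i) = None ->
        forall i, n i = 0).

Definition f1 : {poly rat} := 'X^2 + (2 ^+ 5)%:P.
Definition g1 : {poly rat} := - (2 ^+ 4)%:P * 'X.
Definition h1 : {poly rat} := - ('X^2 - (2 ^+ 5)%:P).

(* The denominator never vanishes, since 10 is not a square in Q. *)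
Definition param (t : rat) : rat := (- 2 ^+ 4 * t) / (- 10 + t ^+ 2).

Definition triples : set (rat * rat * rat) :=
  [set (f1.[param t], g1.[param t], h1.[param t]) | t in [set t : rat | t != 0]].

Definition E (a b c : rat) : {poly rat} :=
  'X * ('X + (2 * a ^+ 2)%:P) * ('X - (b ^+ 2)%:P).

(* Main.v *)
From HB Require Import structures.
Require Import Defs.
From mathcomp Require Import all_boot all_order all_algebra all_field.
From mathcomp Require Import boolp classical_sets cardinality.
From mathcomp Require Import ring lra zify.

(** Write u for the parameter, so that a = u^2 + 32, b = -16 u, c = 32 - u^2 and
    10 u^2 + 64 = w^2.  The three points
    (-2 c^2, 2abc), (2 a^2, 4 a^2 c) and (8 u^2 a, 8 u^3 a w)
    lie on the curve and no exception is needed.  Reduce each x - e modulo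
    squares, for the roots e = 0 and e = -2a^2.  If D = 2a^2 + b^2, the points map
    to (-2, 1), (2, 1), (2a, a), and the 2-torsion points with x = 0, -2a^2, b^2
    map to (-2, 2), (-2, 2D), (1, D).  Hence, as soon as 2, a, 2a, D and 2D are
    not squares, a combination of the three points which is 2-torsion has even
    coefficients, and is twice a combination which is again 2-torsion; so all
    coefficients vanish.
    The numbers a and D are not squares by a 2-adic argument.  If 2a is a square
    then so is t^4 - 12 t^2 + 100, and if 2D is a square then so is
    r^4 + 12 r^2 + 4 with r = u / 4; both quartics are handled by infinite
    descent, the second one through Fermat's equation x^4 + y^4 = z^2. *)

Import Order.TTheory GRing.Theory Num.Theory.
Local Open Scope classical_set_scope.
Local Open Scope ring_scope.

(** * Divisibility and squares of integers *)

(** The first two points exist whenever b^2 = 2 a^2 - 2 c^2. The third is what restricts u: 8 u^2 a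
    + 2 a^2 = a (10 u^2 + 64), so w must be rational, and [param] parametrizes the conic w^2 = 10
    u^2 + 64 by the lines of slope -t through (0, -8). A specialization argument would prove
    independence outside some exceptional set. Here each condition becomes a quartic in one
    variable, by a (t^2 - 10)^2 = 32 (t^4 - 12 t^2 + 100) and D = 512 (r^4 + 12 r^2 + 4). For 2a and
    2D these have the solutions t = 0 and r = 0, so no congruence can dispose of them, and descent
    has to show that the excluded values are the only ones. Two roots e are used because at e = 0
    the first point and the torsion points over 0 and -2a^2 all have class -2; the values at e =
    -2a^2 separate them. The chord-tangent law is given by formulas only, so its associativity has
    to be proved before sums can be regrouped. *)

Lemma prime_dvdzM (l : nat) (a b : int) : prime l ->
  (l%:Z %| a * b)%Z = (l%:Z %| a)%Z || (l%:Z %| b)%Z.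
Proof. by move=> pl; rewrite !dvdzE abszM Euclid_dvdM. Qed.

Lemma prime_dvdzX (l k : nat) (a : int) : prime l ->
  (l%:Z %| a ^+ k)%Z -> (l%:Z %| a)%Z.
Proof. by move=> pl; rewrite !dvdzE abszX Euclid_dvdX // => /andP[]. Qed.

Lemma coprimez_primeP (a b : int) :
  reflect (forall l : nat, prime l -> (l%:Z %| a)%Z -> (l%:Z %| b)%Z -> False)
          (coprimez a b).
Proof.
apply: (iffP idP) => [cab l pl la lb|h].
  have : (l %| gcdn `|a| `|b|)%N by rewrite dvdn_gcd -!(dvdzE l%:Z) la.
  by rewrite (eqP (cab : coprime _ _)) dvdn1 => /eqP l1; rewrite l1 in pl.
rewrite coprimezE /coprime; apply/negPn/negP => g1.
have [g0|gp] := posnP (gcdn `|a| `|b|).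
  move/eqP: g0; rewrite -leqn0 leqNgt gcdn_gt0 negb_or -!leqNgt !leqn0 !absz_eq0.
  by case/andP => /eqP a0 /eqP b0; apply: (h 2) => //; rewrite ?a0 ?b0 dvdz0.
have pp : prime (pdiv (gcdn `|a| `|b|)) by apply: pdiv_prime; lia.
by apply: (h _ pp); rewrite dvdzE (dvdn_trans (pdiv_dvd _)) ?dvdn_gcdl ?dvdn_gcdr.
Qed.

(** The square root is gcd(a, c). Dividing m n = w^2 by d = gcd(m, w) leaves m' n = d w'^2; as m' is
    coprime to w' and d to n, m' and d divide each other, so m = d^2. *)
Lemma coprimez_square (a b c : int) :
  coprimez a b -> 0 <= a -> a * b = c ^+ 2 -> exists d, a = d ^+ 2.
Proof.
move=> cab a0 e; case: a a0 cab e => // m _ cab e.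
have {e} : (m * `|b| = `|c| ^ 2)%N by rewrite -abszX -e abszM.
have {cab} : coprime m `|b| by [].
move: (`|b|)%N (`|c|)%N => n w cmn e.
have [m0|mp] := posnP m; first by exists 0; rewrite m0.
suff : m = (gcdn m w ^ 2)%N by move=> {1}->; exists (gcdn m w)%:Z.
have gp : (0 < gcdn m w)%N by rewrite gcdn_gt0 mp.
have [[m' em] [w' ew]] := (dvdnP (dvdn_gcdl m w), dvdnP (dvdn_gcdr m w)).
move ed: (gcdn m w) gp em ew => d dp em ew.
have cm : coprime m' w'.
  by rewrite /coprime -(eqn_pmul2r dp) mul1n muln_gcdl -em -ew ed.
have e2 : (m' * n = d * w' ^ 2)%N.
  apply/eqP; rewrite -(eqn_pmul2l dp) -(eqn_pmul2l dp); apply/eqP.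
  have -> : (d * (d * (m' * n)) = d * (m' * d * n))%N by lia.
  by rewrite -em e ew; lia.
have d1 : (m' %| d)%N.
  have cm2 : coprime m' (w' ^ 2) by apply: coprimeXr.
  by rewrite -(Gauss_dvdl _ cm2) -e2 dvdn_mulr ?dvdnn.
have d2 : (d %| m')%N.
  have cdn : coprime d n by apply: coprime_dvdl cmn; rewrite em dvdn_mull ?dvdnn.
  by rewrite -(Gauss_dvdl _ cdn) e2 dvdn_mulr ?dvdnn.
have -> : m = (m' * d)%N by [].
by have /eqP -> : m' == d; rewrite ?eqn_dvd ?d1 // -mulnn.
Qed.

(** Coprimality determines the factors of a square only up to sign; the sign is settled later,
    modulo 8, by positivity, or by squaring. *)
Definition pm_square (a : int) : Prop := exists d, a = d ^+ 2 \/ a = - d ^+ 2.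

Lemma coprimez_pm_square (a b : int) :
  coprimez a b -> pm_square (a * b) -> pm_square a /\ pm_square b.
Proof.
wlog suff main : a b / coprimez a b -> pm_square (a * b) -> pm_square a.
  move=> cab sab; split; first exact: main sab.
  by apply: (main _ a); rewrite 1?coprimez_sym // mulrC.
move=> cab [c ec].
have eab : `|a| * `|b| = c ^+ 2.
  rewrite -normrM; case: ec => ->; rewrite ?normrN ger0_norm ?sqr_ge0 //.
have cab' : coprimez `|a| `|b| by rewrite coprimezE !absz_id.
have [d ed] := coprimez_square _ _ _ cab' (normr_ge0 a) eab.
by exists d; rewrite -ed; have [] := ger0P a => _; [left | right; rewrite opprK].
Qed.

Lemma ler_norm_sqr (a : int) : `|a| <= a ^+ 2.
Proof.
rewrite -real_normK ?num_real //; have := normr_ge0 a; move: `|a| => b b0.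
have [->|b1] : b = 0 \/ 1 <= b by lia.
  by rewrite expr0n.
by rewrite expr2 ler_peMl.
Qed.

Lemma parityz (x : int) : (exists k, x = 2 * k) \/ (exists k, x = 2 * k + 1).
Proof.
have e := divz_eq x 2; have := modz_ge0 x (isT : 2 != 0 :> int).
have := ltz_pmod x (isT : 0 < 2 :> int).
case: ((x %% 2)%Z =P 0) => h; [left|right]; exists (x %/ 2)%Z; lia.
Qed.

Lemma odd_square_mod8 (x k : int) : x = 2 * k + 1 -> exists j, x ^+ 2 = 8 * j + 1.
Proof.
have [[j ej]|[j ej]] := parityz k => ->.
  by exists (2 * j ^+ 2 + j); rewrite ej; ring.
by exists (2 * j ^+ 2 + 3 * j + 1); rewrite ej; ring.
Qed.

Lemma square_mod8 (x : int) :
  exists j, [\/ x ^+ 2 = 8 * j, x ^+ 2 = 8 * j + 1 | x ^+ 2 = 8 * j + 4].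
Proof.
have [[k ek]|[k /odd_square_mod8[j ->]]] := parityz x; last first.
  by exists j; constructor 2.
have [[j ej]|[j ej]] := parityz k.
  by exists (2 * j ^+ 2); constructor 1; rewrite ek ej; ring.
by exists (2 * j ^+ 2 + 2 * j); constructor 3; rewrite ek ej; ring.
Qed.

Lemma square_mod5 (x : int) :
  exists j, [\/ x = 5 * j, x ^+ 2 = 5 * j + 1 | x ^+ 2 = 5 * j - 1].
Proof.
have e := divz_eq x 5; have := modz_ge0 x (isT : 5 != 0 :> int).
have := ltz_pmod x (isT : 0 < 5 :> int).
move: (x %% 5)%Z (x %/ 5)%Z e => r q -> h1 h2.
have : r \in [:: 0; 1; 2; 3; 4] by rewrite !inE; lia.
rewrite !inE; case/or4P => [/eqP->|/eqP->|/eqP->|/orP[]/eqP->].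
- by exists q; constructor 1; ring.
- by exists (5 * q ^+ 2 + 2 * q); constructor 2; ring.
- by exists (5 * q ^+ 2 + 4 * q + 1); constructor 3; ring.
- by exists (5 * q ^+ 2 + 6 * q + 2); constructor 3; ring.
- by exists (5 * q ^+ 2 + 8 * q + 3); constructor 2; ring.
Qed.

(** * Pythagorean triples and Fermat's quartic equation *)

Lemma pythagorean (a b c k : int) : coprimez a b -> a = 2 * k + 1 -> 0 <= c ->
  a ^+ 2 + b ^+ 2 = c ^+ 2 -> exists m n, [/\ coprimez m n,
    a = m ^+ 2 - n ^+ 2, b = 2 * m * n & c = m ^+ 2 + n ^+ 2].
Proof.
move=> cab ea c0 e.
have [ja ha] := odd_square_mod8 _ _ ea.
have [b' eb] : exists b', b = 2 * b'.
  have [//|[kb eb]] := parityz b.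
  have [jb hb] := odd_square_mod8 _ _ eb.
  have [jc] := square_mod8 c.
  by rewrite -e ha hb => -[]; lia.
have [c' ec] : exists c', c = 2 * c' + 1.
  have [[kc ec]|//] := parityz c.
  have [jc hc] := square_mod8 b.
  by have : c ^+ 2 = 4 * kc ^+ 2 by [rewrite ec; ring]; rewrite -e ha; case: hc => ->; lia.
(* These are (c - a) / 2 and (c + a) / 2, with product (b / 2)^2. *)
pose u := c' - k; pose v := c' + k + 1.
have euv : u * v = b' ^+ 2.
  have : 4 * (u * v) = 4 * b' ^+ 2.
    have -> : 4 * b' ^+ 2 = c ^+ 2 - a ^+ 2 by rewrite -e eb; ring.
    by rewrite /u /v ec ea; ring.
  by lia.
have cuv : coprimez u v.
  apply/coprimez_primeP => l pl lu lv.
  have la : (l%:Z %| a)%Z.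
    by have -> : a = v - u by [rewrite ea /u /v; ring]; rewrite rpredB.
  have lb : (l%:Z %| b')%Z by apply: (@prime_dvdzX l 2) => //; rewrite -euv dvdz_mulr.
  by apply: (elimT (coprimez_primeP a b) cab l pl la); rewrite eb dvdz_mull.
have ac : `|a| <= c.
  by rewrite -ler_sqr ?nnegrE // real_normK ?num_real // -e lerDl sqr_ge0.
have [u0 v0] : 0 <= u /\ 0 <= v by rewrite /u /v; lia.
have [n en] := coprimez_square _ _ _ cuv u0 euv.
have [m em] : exists m, v = m ^+ 2.
  by apply: (coprimez_square _ u b') => //; rewrite 1?coprimez_sym // mulrC.
have : b' ^+ 2 = (m * n) ^+ 2 by rewrite -euv en em; ring.
move/eqP; rewrite eqf_sqr => bmn.
have cmn : coprimez m n.
  by move: cuv; rewrite en em coprimez_pexpl // coprimez_pexpr // coprimez_sym.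
have ea' : a = m ^+ 2 - n ^+ 2 by rewrite -em -en ea /u /v; ring.
have ec' : c = m ^+ 2 + n ^+ 2 by rewrite -em -en ec /u /v; ring.
case/orP: bmn => /eqP eb'; [exists m, n | exists m, (- n)]; split=> //.
- by rewrite eb eb'; ring.
- by rewrite coprimezN.
- by rewrite sqrrN.
- by rewrite eb eb'; ring.
- by rewrite sqrrN.
Qed.

(* Parametrizing the triples (x^2, y^2, z) and then (x, n, m) makes r, s and
   m = r^2 + s^2 squares, which is a smaller solution. *)
Lemma fermat4 (x y z : int) :
  coprimez x y -> x ^+ 4 + y ^+ 4 = z ^+ 2 -> x * y = 0.
Proof.
have [N] := ubnP `|z|%N; elim: N => // N IHN in x y z *.
move=> zN cxy e; apply/eqP/negPn/negP => xy0.
wlog z0 : z zN e / 0 <= z.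
  move=> wl; have [|zlt] := leP 0 z; first exact: wl.
  by apply: (wl (- z)); rewrite ?abszN ?sqrrN // oppr_ge0 ltW.
wlog [k ek] : x y cxy e xy0 / exists k, x = 2 * k + 1.
  move=> wl; have [[kx ex]|] := parityz x; last exact: (wl x y).
  have [[ky ey]|] := parityz y; last first.
    by apply: (wl y x); rewrite 1?coprimez_sym 1?addrC 1?[y * x]mulrC.
  by have := elimT (coprimez_primeP x y) cxy 2%N isT; rewrite ex ey !dvdz_mulr //; apply.
have [x0 y0] : x != 0 /\ y != 0 by move: xy0; rewrite mulf_eq0 negb_or => /andP.
have e' : (x ^+ 2) ^+ 2 + (y ^+ 2) ^+ 2 = z ^+ 2 by rewrite -!exprM.
have cxy2 : coprimez (x ^+ 2) (y ^+ 2) by rewrite coprimez_pexpl // coprimez_pexpr.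
have [j ej] := odd_square_mod8 _ _ ek.
have ek2 : x ^+ 2 = 2 * (4 * j) + 1 by rewrite ej; ring.
have [m [n [cmn ex ey ez]]] := pythagorean _ _ _ _ cxy2 ek2 z0 e'.
wlog m0 : m n cmn ex ey ez / 0 <= m.
  move=> wl; have [|mlt] := leP 0 m; first exact: (wl m n).
  apply: (wl (- m) (- n)).
  - by rewrite coprimezN coprimez_sym coprimezN coprimez_sym.
  - by rewrite !sqrrN.
  - by rewrite ey; ring.
  - by rewrite !sqrrN.
  - by rewrite oppr_ge0 ltW.
have n0 : n != 0 by apply: contraNneq y0 => n0; rewrite -sqrf_eq0 ey n0 mulr0.
have cxn : coprimez x n.
  apply/coprimez_primeP => l pl lx ln; apply: (elimT (coprimez_primeP m n) cmn l pl _ ln).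
  apply: (prime_dvdzX l 2) => //.
  have -> : m ^+ 2 = x ^+ 2 + n ^+ 2 by rewrite ex; ring.
  by rewrite rpredD // expr2 dvdz_mulr.
have exn : x ^+ 2 + n ^+ 2 = m ^+ 2 by rewrite ex; ring.
have [r [s [crs _ en em]]] := pythagorean _ _ _ _ cxn ek m0 exn.
have [y' ey'] : exists y', y = 2 * y'.
  have [//|[ky eky]] := parityz y.
  have [jy] := odd_square_mod8 _ _ eky; rewrite ey -mulrA.
  by move: (m * n) => mn; clear; lia.
have ers : m * (r * s) = y' ^+ 2.
  apply: (@mulfI _ (4 : int)) => //.
  have -> : 4 * y' ^+ 2 = y ^+ 2 by rewrite ey'; ring.
  by rewrite ey en; ring.
have cmrs : coprimez m (r * s).
  apply/coprimez_primeP => l pl lm; rewrite prime_dvdzM // => /orP[] lr.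
    apply: (elimT (coprimez_primeP r s) crs l pl lr); apply: (prime_dvdzX l 2) => //.
    have -> : s ^+ 2 = m - r ^+ 2 by rewrite em; ring.
    by rewrite rpredB // expr2 dvdz_mulr.
  apply: (elimT (coprimez_primeP r s) crs l pl _ lr); apply: (prime_dvdzX l 2) => //.
  have -> : r ^+ 2 = m - s ^+ 2 by rewrite em; ring.
  by rewrite rpredB // expr2 dvdz_mulr.
have [Z eZ] := coprimez_square _ _ _ cmrs m0 ers.
have [_ hrs] : pm_square m /\ pm_square (r * s).
  by apply: coprimez_pm_square => //; exists y'; left.
have [[X hX] [Y hY]] := coprimez_pm_square _ _ crs hrs.
have X4 : r ^+ 2 = X ^+ 4 by case: hX => ->; ring.
have Y4 : s ^+ 2 = Y ^+ 4 by case: hY => ->; ring.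
have cXY : coprimez X Y.
  rewrite -(@coprimez_pexpl 4) // -(@coprimez_pexpr 4) // -X4 -Y4.
  by rewrite coprimez_pexpl ?coprimez_pexpr.
(* |Z| <= Z^2 = m <= m^2 < m^2 + n^2 = z, strictly because n is nonzero. *)
have ZN : (`|Z| < N)%N.
  have : `|Z| < z; last by move: zN; clear; lia.
  have n1 : 0 < n ^+ 2 by rewrite lt0r sqrf_eq0 n0 sqr_ge0.
  have h1 := ler_norm_sqr m; rewrite (ger0_norm m0) {1}eZ in h1.
  by rewrite ez (le_lt_trans (ler_norm_sqr Z)) // (le_lt_trans h1) // ltrDl.
have eXYZ : X ^+ 4 + Y ^+ 4 = Z ^+ 2 by rewrite -X4 -Y4 -em.
have /eqP := IHN X Y Z ZN cXY eXYZ.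
rewrite mulf_eq0 => /orP[] /eqP h; case/eqP: n0; rewrite en.
  by have /eqP := X4; rewrite h expr0n sqrf_eq0 => /eqP->; rewrite mulr0 mul0r.
by have /eqP := Y4; rewrite h expr0n sqrf_eq0 => /eqP->; rewrite mulr0.
Qed.

(** * Fourth powers, and the quartic p^4 + 12 p^2 q^2 + 4 q^4 *)

Lemma prime_dvdz_prime (l m : nat) : prime l -> prime m -> (l%:Z %| m%:Z)%Z -> l = m.
Proof. by move=> pl pm; rewrite dvdzE /= dvdn_prime2 // => /eqP. Qed.

Lemma prime_dvd_odd (l : nat) (a k : int) : (l%:Z %| a)%Z -> a = 2 * k + 1 -> l != 2%N.
Proof.
by move=> la ea; apply/eqP => el; move: la; rewrite el ea => /dvdzP[q]; clear; lia.
Qed.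

(** Square roots are extracted twice: a = c^2 and b = d^2 with c d = q^2 up to sign, and then c and
    d are squares up to sign. The sign of q against x y is lost, so the last clause compares
    squares. *)
Lemma coprimez_fourth (a b q : int) : coprimez a b -> 0 <= a -> 0 <= b -> a * b = q ^+ 4 ->
  exists x y, [/\ coprimez x y, a = x ^+ 4, b = y ^+ 4 & q ^+ 2 = x ^+ 2 * y ^+ 2].
Proof.
move=> cab a0 b0 e.
have e2 : a * b = (q ^+ 2) ^+ 2 by rewrite e -exprM.
have [c ec] := coprimez_square _ _ _ cab a0 e2.
have [d ed] : exists d, b = d ^+ 2.
  by apply: (coprimez_square _ a (q ^+ 2)); rewrite // 1?coprimez_sym 1?mulrC.
have ccd : coprimez c d by move: cab; rewrite ec ed coprimez_pexpl // coprimez_pexpr.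
have /eqP : (q ^+ 2) ^+ 2 = (c * d) ^+ 2 by rewrite -e2 ec ed; ring.
rewrite eqf_sqr => ecd.
have [[x hx] [y hy]] : pm_square c /\ pm_square d.
  apply: coprimez_pm_square => //; exists q.
  by case/orP: ecd => /eqP ->; [left | right; rewrite opprK].
have ex : c ^+ 2 = x ^+ 4 by case: hx => ->; ring.
have ey : d ^+ 2 = y ^+ 4 by case: hy => ->; ring.
have cxy : coprimez x y.
  have : coprimez (x ^+ 4) (y ^+ 4) by rewrite -ex -ey -ec -ed.
  by rewrite coprimez_pexpl // coprimez_pexpr.
exists x, y; split=> //; [by rewrite ec | by rewrite ed |].
have xy0 : 0 <= x ^+ 2 * y ^+ 2 by rewrite mulr_ge0 ?sqr_ge0.
apply/eqP; rewrite -(eqrXn2 (isT : 0 < 2)%N (sqr_ge0 q) xy0); apply/eqP.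
rewrite -e2 ec ed ex ey; ring.
Qed.

(* Neither 2 nor -2 is a square modulo 5. *)
Lemma dvd5_form (x y : int) (d : bool) : (5%:Z %| x ^+ 2 + (-1) ^+ d * 2 * y ^+ 2)%Z ->
  (5%:Z %| x)%Z /\ (5%:Z %| y)%Z.
Proof.
have [i hi] := square_mod5 x; have [j hj] := square_mod5 y => h.
have y5 : (5%:Z %| y)%Z.
  have [i' x2] : exists i', [\/ x ^+ 2 = 5 * i', x ^+ 2 = 5 * i' + 1 | x ^+ 2 = 5 * i' - 1].
    case: hi => [->|->|->]; first by exists (5 * i ^+ 2); constructor 1; ring.
      by exists i; constructor 2.
    by exists i; constructor 3.
  clear hi; case: hj h => [->|->|->]; first by rewrite dvdz_mulr.
    move: x2; move: (x ^+ 2) => X.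
    by case: d; case=> ->; case/dvdzP => q; rewrite ?expr1 ?expr0; lia.
  move: x2; move: (x ^+ 2) => X.
  by case: d; case=> ->; case/dvdzP => q; rewrite ?expr1 ?expr0; lia.
split=> //; apply: (prime_dvdzX 5 2) => //.
have -> : x ^+ 2 = (x ^+ 2 + (-1) ^+ d * 2 * y ^+ 2) - (-1) ^+ d * 2 * y * y by ring.
by rewrite rpredB // dvdz_mull.
Qed.

Lemma odd_of_square (x j : int) : x ^+ 2 = 2 * j + 1 -> exists k, x = 2 * k + 1.
Proof.
have [[k ->]|//] := parityz x.
have -> : (2 * k) ^+ 2 = 2 * (2 * k ^+ 2) by ring.
by move: (2 * k ^+ 2) => z; lia.
Qed.

(** Both coprime factors are minus a square: 4 x^2 - y^2 is 3 or 7 modulo 8, and the other factor is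
    smaller. The triple s^2 + (2x)^2 = y^2 gives |y| = m^2 + n^2 and x = m n, so the square y^2 - 2
    x^2 equals m^4 + n^4 and [fermat4] applies. *)
Lemma quartic12_4_split (p q x y : int) : coprimez x y -> (exists k, y = 2 * k + 1) ->
  (exists k, p = 2 * k + 1) ->
  q ^+ 2 = x ^+ 2 * y ^+ 2 -> p ^+ 2 = (2 * x ^+ 2 - y ^+ 2) * (4 * x ^+ 2 - y ^+ 2) ->
  q = 0.
Proof.
move=> cxy [k ek] [kp ep] eq e.
have [i hi] := odd_square_mod8 _ _ ek.
have cf : coprimez (2 * x ^+ 2 - y ^+ 2) (4 * x ^+ 2 - y ^+ 2).
  apply/coprimez_primeP => l pl l1 l2.
  have ly : (l%:Z %| y)%Z.
    apply: (prime_dvdzX l 2) => //.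
    have -> : y ^+ 2 = (4 * x ^+ 2 - y ^+ 2) - 2 * (2 * x ^+ 2 - y ^+ 2) by ring.
    by rewrite rpredB // dvdz_mull.
  have : (l%:Z %| 2 * x ^+ 2)%Z.
    have -> : 2 * x ^+ 2 = (4 * x ^+ 2 - y ^+ 2) - (2 * x ^+ 2 - y ^+ 2) by ring.
    by rewrite rpredB.
  rewrite prime_dvdzM // => /orP[/(prime_dvdz_prime _ 2 pl isT) l2'|/(prime_dvdzX _ _ _ pl) lx].
    by have := prime_dvd_odd _ _ _ ly ek; rewrite l2' eqxx.
  exact: (elimT (coprimez_primeP x y) cxy l pl lx ly).
have [[r hr] [s hs]] := coprimez_pm_square _ _ cf (ex_intro _ p (or_introl (esym e))).
have s0 := sqr_ge0 s; have r0 := sqr_ge0 r; have x0 := sqr_ge0 x.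
have es : y ^+ 2 - 4 * x ^+ 2 = s ^+ 2.
  case: hs => hs; last by rewrite -[s ^+ 2]opprK -hs; ring.
  have [js] := square_mod8 s; rewrite -hs hi; by move: (x ^+ 2) => X []; clear; lia.
have er : y ^+ 2 - 2 * x ^+ 2 = r ^+ 2.
  case: hr => hr; last by rewrite -[r ^+ 2]opprK -hr; ring.
  move: hr es s0 r0 x0; rewrite hi.
  move: (x ^+ 2) (r ^+ 2) (s ^+ 2) => X R S; clear; lia.
have [ks eks] : exists ks, s = 2 * ks + 1.
  apply: (odd_of_square _ (4 * i - 2 * x ^+ 2)); rewrite -es hi; ring.
have csx : coprimez s (2 * x).
  apply/coprimez_primeP => l pl ls.
  rewrite prime_dvdzM // => /orP[/(prime_dvdz_prime _ 2 pl isT) l2'|lx].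
    by have := prime_dvd_odd _ _ _ ls eks; rewrite l2' eqxx.
  apply: (elimT (coprimez_primeP x y) cxy l pl lx); apply: (prime_dvdzX l 2) => //.
  have -> : y ^+ 2 = s * s + 4 * x * x by rewrite -expr2 -es; ring.
  by rewrite rpredD // dvdz_mull.
have ey : s ^+ 2 + (2 * x) ^+ 2 = `|y| ^+ 2.
  by rewrite real_normK ?num_real // -es; ring.
have [m [n [cmn _ exmn eymn]]] := pythagorean _ _ _ _ csx eks (normr_ge0 y) ey.
have ex : x = m * n by apply: (@mulfI _ (2 : int)) => //; rewrite exmn; ring.
have eF : m ^+ 4 + n ^+ 4 = r ^+ 2.
  rewrite -er -[y ^+ 2]real_normK ?num_real // eymn ex; ring.
have mn0 := fermat4 _ _ _ cmn eF.
by apply/eqP; rewrite -sqrf_eq0 eq ex mn0 expr0n mul0r.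
Qed.

Lemma ge0_pair (u v : int) : 0 <= u * v -> 0 <= u + v -> 0 <= u /\ 0 <= v.
Proof.
move=> muv suv.
have [u0|u0] := leP 0 u; have [v0|v0] := leP 0 v; split=> //; exfalso.
- have [u1|u1] : u = 0 \/ 0 < u by lia.
    by move: suv v0; rewrite u1; lia.
  by move: muv; rewrite pmulr_rge0 // leNgt v0.
- have [v1|v1] : v = 0 \/ 0 < v by lia.
    by move: suv u0; rewrite v1; lia.
  by move: muv; rewrite pmulr_lge0 // leNgt u0.
- by lia.
- by lia.
Qed.

(** Completing the square, (p^2 + 6 q^2)^2 - w^2 = 32 q^4, so the numbers u, v = (p^2 + 6 q^2 -+ w)
    / 2 are coprime with product 8 q^4 and odd sum. The even one is 8 x^4, the odd one y^4, and p^2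
    = 8 x^4 + y^4 - 6 x^2 y^2 factors. *)
Lemma quartic12_4 (p q w : int) : coprimez p q -> (exists k, p = 2 * k + 1) ->
  p ^+ 4 + 12 * p ^+ 2 * q ^+ 2 + 4 * q ^+ 4 = w ^+ 2 -> q = 0.
Proof.
move=> cpq [k ek] e.
wlog w0 : w e / 0 <= w.
  move=> wl; have [|wlt] := leP 0 w; first exact: wl.
  by apply: (wl (- w)); rewrite ?sqrrN // oppr_ge0 ltW.
have [j hj] := odd_square_mod8 _ _ ek.
have [c ec] : exists c, w = 2 * c + 1.
  apply: (odd_of_square _ (32 * j ^+ 2 + 8 * j + 6 * p ^+ 2 * q ^+ 2 + 2 * q ^+ 4)).
  rewrite -e; have -> : p ^+ 4 = (8 * j + 1) ^+ 2 by rewrite -hj; ring.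
  by ring.
pose u := 4 * j + 3 * q ^+ 2 - c; pose v := 4 * j + 3 * q ^+ 2 + c + 1.
have euv : u + v = p ^+ 2 + 6 * q ^+ 2 by rewrite hj /u /v; ring.
have muv : u * v = 8 * q ^+ 4.
  apply: (@mulfI _ (4 : int)) => //.
  have -> : 4 * (u * v) = (p ^+ 2 + 6 * q ^+ 2) ^+ 2 - w ^+ 2.
    by rewrite hj ec /u /v; ring.
  by rewrite -e; ring.
have [u0 v0] : 0 <= u /\ 0 <= v.
  apply: ge0_pair.
    by rewrite muv mulr_ge0 // -[4%N]/(2 * 2)%N exprM sqr_ge0.
  by rewrite euv addr_ge0 ?sqr_ge0 // mulr_ge0 ?sqr_ge0.
have ouv : u + v = 2 * (4 * j + 3 * q ^+ 2) + 1 by rewrite /u /v; ring.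
have cuv : coprimez u v.
  apply/coprimez_primeP => l pl lu lv.
  have : (l%:Z %| 8 * q ^+ 4)%Z by rewrite -muv dvdz_mull.
  have luv : (l%:Z %| p ^+ 2 + 6 * q ^+ 2)%Z by rewrite -euv rpredD.
  rewrite prime_dvdzM // => /orP[l8|/(prime_dvdzX _ _ _ pl) lq].
    have := prime_dvdzX l 3 2 pl l8 => /(prime_dvdz_prime _ 2 pl isT) l2.
    have := prime_dvd_odd _ _ _ luv (etrans (esym euv) ouv).
    by rewrite l2 eqxx.
  apply: (elimT (coprimez_primeP p q) cpq l pl _ lq); apply: (prime_dvdzX l 2) => //.
  have -> : p ^+ 2 = (p ^+ 2 + 6 * q ^+ 2) - 6 * q * q by ring.
  by rewrite rpredB // dvdz_mull.
(* What is kept about u and v is symmetric, so v may be assumed odd. *)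
clearbody u v.
wlog [kv ekv] : u v euv muv v0 u0 ouv cuv / exists kv, v = 2 * kv + 1.
  move=> wl; have [[kv ekv]|] := parityz v; last exact: (wl u v).
  apply: (wl v u) => //; do ?by [rewrite addrC | rewrite mulrC | rewrite coprimez_sym].
  by exists (4 * j + 3 * q ^+ 2 - kv); move: ouv; rewrite ekv; move: (q ^+ 2); clear; lia.
have [u' eu] : exists u', u = 8 * u'.
  have : (8%:Z %| u * v)%Z by rewrite muv dvdz_mulr.
  have c8 : coprimez 8%:Z v.
    apply/coprimez_primeP => l pl l8 lv.
    have := prime_dvdzX l 3 2 pl l8 => /(prime_dvdz_prime _ 2 pl isT) l2.
    by have := prime_dvd_odd _ _ _ lv ekv; rewrite l2 eqxx.
  by rewrite (Gauss_dvdzl _ c8) => /dvdzP[u' ->]; exists u'; rewrite mulrC.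
have u'0 : 0 <= u' by move: u0; rewrite eu pmulr_rge0.
have cu' : coprimez u' v by move: cuv; rewrite eu coprimezMl => /andP[].
have mu' : u' * v = q ^+ 4.
  by apply: (@mulfI _ (8 : int)) => //; rewrite -muv eu; ring.
have [x [y [cxy ex ey exy]]] := coprimez_fourth _ _ _ cu' u'0 v0 mu'.
apply: (quartic12_4_split p q x y) => //; last first.
- have -> : p ^+ 2 = u + v - 6 * q ^+ 2 by rewrite euv; ring.
  by rewrite eu ex ey exy; ring.
- by exists k.
have [ky2 eky2] : exists k, y ^+ 2 = 2 * k + 1.
  by apply: (odd_of_square _ kv); rewrite -ekv ey; ring.
exact: odd_of_square eky2.
Qed.

(** * Concordant forms, and the quartic p^4 - 12 p^2 q^2 + 100 q^4 *)

Lemma odd_square_ge1 (x k : int) : x = 2 * k + 1 -> 1 <= x ^+ 2.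
Proof.
move=> /odd_square_mod8[j hj]; have := sqr_ge0 x.
by rewrite hj; lia.
Qed.

(** The right side is (b^2 - 8 a^2) (b^2 - 10 a^2) with coprime factors. The first is 1 modulo 8,
    hence a square j^2, and y being odd the second is a square too. So j and a solve the system of
    [concordant] again, the old b being the root of j^2 + 8 a^2. *)
Lemma concordant_step (x y a b : int) : coprimez a b -> (exists k, b = 2 * k + 1) ->
  (exists k, y = 2 * k + 1) ->
  y ^+ 2 = 80 * a ^+ 4 + b ^+ 4 - 18 * a ^+ 2 * b ^+ 2 ->
  exists j k, [/\ coprimez j a, exists i, j = 2 * i + 1,
    j ^+ 2 - 2 * a ^+ 2 = k ^+ 2 & j ^+ 2 + 8 * a ^+ 2 = b ^+ 2].
Proof.
move=> cab [kb ekb] [ky eky] e.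
have [i hi] := odd_square_mod8 _ _ ekb.
have ef : (b ^+ 2 - 8 * a ^+ 2) * (b ^+ 2 - 10 * a ^+ 2) = y ^+ 2 by rewrite e; ring.
have cf : coprimez (b ^+ 2 - 8 * a ^+ 2) (b ^+ 2 - 10 * a ^+ 2).
  apply/coprimez_primeP => l pl l1 l2.
  have : (l%:Z %| 2 * a ^+ 2)%Z.
    have -> : 2 * a ^+ 2 = (b ^+ 2 - 8 * a ^+ 2) - (b ^+ 2 - 10 * a ^+ 2) by ring.
    by rewrite rpredB.
  rewrite prime_dvdzM // => /orP[/(prime_dvdz_prime _ 2 pl isT) l2'|/(prime_dvdzX _ _ _ pl) la].
    have ob : b ^+ 2 - 8 * a ^+ 2 = 2 * (4 * i - 4 * a ^+ 2) + 1 by rewrite hi; ring.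
    by have := prime_dvd_odd _ _ _ l1 ob; rewrite l2' eqxx.
  apply: (elimT (coprimez_primeP a b) cab l pl la); apply: (prime_dvdzX l 2) => //.
  have -> : b ^+ 2 = (b ^+ 2 - 8 * a ^+ 2) + 8 * a * a by ring.
  by rewrite rpredD // dvdz_mull.
have [[j hj] [k hk]] := coprimez_pm_square _ _ cf (ex_intro _ y (or_introl ef)).
have ej : b ^+ 2 - 8 * a ^+ 2 = j ^+ 2.
  case: hj => // hj; have [t] := square_mod8 j.
  have -> : j ^+ 2 = 8 * a ^+ 2 - (8 * i + 1) by rewrite -hi -[j ^+ 2]opprK -hj; ring.
  by move: (a ^+ 2) => A []; clear; lia.
have ek : b ^+ 2 - 10 * a ^+ 2 = k ^+ 2.
  case: hk => // hk.
  have y1 : y ^+ 2 + (j * k) ^+ 2 = 0 by rewrite -ef ej hk; ring.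
  have [t ht] := odd_square_mod8 _ _ eky.
  have := sqr_ge0 (j * k); have := sqr_ge0 y; move: y1; rewrite ht.
  by move: ((j * k) ^+ 2) => A; clear; lia.
have ej' : j ^+ 2 + 8 * a ^+ 2 = b ^+ 2 by rewrite -ej; ring.
exists j, k; split=> //; last by rewrite -ek -ej; ring.
  apply/coprimez_primeP => l pl lj la.
  apply: (elimT (coprimez_primeP a b) cab l pl la); apply: (prime_dvdzX l 2) => //.
  have -> : b ^+ 2 = j * j + 8 * a * a by rewrite -ej'; ring.
  by rewrite rpredD // dvdz_mull.
by apply: (odd_of_square _ (4 * i - 4 * a ^+ 2)); rewrite -ej hi; ring.
Qed.

(** The alternative to the equation of [concordant_step], with the 5 next to b^4. The coprime factor
    8 a^2 - 5 b^2 is 3 modulo 8, so neither it nor its negative is a square. *)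
Lemma concordant_split (a b y : int) : (exists k, b = 2 * k + 1) -> coprimez a b ->
  y ^+ 2 = 16 * a ^+ 4 + 5 * b ^+ 4 - 18 * a ^+ 2 * b ^+ 2 -> False.
Proof.
move=> [kb ekb] cab e.
have [i hi] := odd_square_mod8 _ _ ekb.
have ef : (2 * a ^+ 2 - b ^+ 2) * (8 * a ^+ 2 - 5 * b ^+ 2) = y ^+ 2 by rewrite e; ring.
have cf : coprimez (2 * a ^+ 2 - b ^+ 2) (8 * a ^+ 2 - 5 * b ^+ 2).
  apply/coprimez_primeP => l pl l1 l2.
  have lb : (l%:Z %| b)%Z.
    apply: (prime_dvdzX l 2) => //.
    have -> : b ^+ 2 = 4 * (2 * a ^+ 2 - b ^+ 2) - (8 * a ^+ 2 - 5 * b ^+ 2) by ring.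
    by rewrite rpredB // dvdz_mull.
  have : (l%:Z %| 2 * a ^+ 2)%Z.
    have -> : 2 * a ^+ 2 = (2 * a ^+ 2 - b ^+ 2) + b * b by ring.
    by rewrite rpredD // dvdz_mull.
  rewrite prime_dvdzM // => /orP[/(prime_dvdz_prime _ 2 pl isT) l2'|/(prime_dvdzX _ _ _ pl) la].
    by have := prime_dvd_odd _ _ _ lb ekb; rewrite l2' eqxx.
  exact: (elimT (coprimez_primeP a b) cab l pl la lb).
have [_ [k]] := coprimez_pm_square _ _ cf (ex_intro _ y (or_introl ef)).
rewrite hi; have [t] := square_mod8 k.
by move: (a ^+ 2) (k ^+ 2) => A K [] -> []; clear; lia.
Qed.

(** As (y^2 + 18 x^2)^2 - r^2 = 320 x^4, the numbers u, v = (y^2 + 18 x^2 -+ r) / 2 are coprime with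
    product 80 x^4. The 16 goes to the even one; the 5 could go to either, but [concordant_split]
    keeps it from the odd one. *)
Lemma concordant_factor (x y r : int) : coprimez x y -> (exists k, y = 2 * k + 1) ->
  4 * x ^+ 4 + 36 * x ^+ 2 * y ^+ 2 + y ^+ 4 = r ^+ 2 ->
  exists a b, [/\ coprimez a b, exists k, b = 2 * k + 1, x ^+ 2 = a ^+ 2 * b ^+ 2 &
    y ^+ 2 = 80 * a ^+ 4 + b ^+ 4 - 18 * a ^+ 2 * b ^+ 2].
Proof.
move=> cxy [k ek] e.
wlog r0 : r e / 0 <= r.
  move=> wl; have [|rlt] := leP 0 r; first exact: wl.
  by apply: (wl (- r)); rewrite ?sqrrN // oppr_ge0 ltW.
have [j hj] := odd_square_mod8 _ _ ek.
have [c ec] : exists c, r = 2 * c + 1.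
  apply: (odd_of_square _ (32 * j ^+ 2 + 8 * j + 18 * x ^+ 2 * y ^+ 2 + 2 * x ^+ 4)).
  rewrite -e; have -> : y ^+ 4 = (8 * j + 1) ^+ 2 by rewrite -hj; ring.
  by ring.
pose u := 4 * j + 9 * x ^+ 2 - c; pose v := 4 * j + 9 * x ^+ 2 + c + 1.
have euv : u + v = y ^+ 2 + 18 * x ^+ 2 by rewrite hj /u /v; ring.
have muv : u * v = 80 * x ^+ 4.
  apply: (@mulfI _ (4 : int)) => //.
  have -> : 4 * (u * v) = (y ^+ 2 + 18 * x ^+ 2) ^+ 2 - r ^+ 2.
    by rewrite hj ec /u /v; ring.
  by rewrite -e; ring.
have [u0 v0] : 0 <= u /\ 0 <= v.
  apply: ge0_pair.
    by rewrite muv mulr_ge0 // -[4%N]/(2 * 2)%N exprM sqr_ge0.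
  by rewrite euv addr_ge0 ?sqr_ge0 // mulr_ge0 ?sqr_ge0.
have ouv : u + v = 2 * (4 * j + 9 * x ^+ 2) + 1 by rewrite /u /v; ring.
have cuv : coprimez u v.
  apply/coprimez_primeP => l pl lu lv.
  have luv : (l%:Z %| y ^+ 2 + 18 * x ^+ 2)%Z by rewrite -euv rpredD.
  suff lx : (l%:Z %| x)%Z.
    apply: (elimT (coprimez_primeP x y) cxy l pl lx); apply: (prime_dvdzX l 2) => //.
    have -> : y ^+ 2 = (y ^+ 2 + 18 * x ^+ 2) - 18 * x * x by ring.
    by rewrite rpredB // dvdz_mull.
  have : (l%:Z %| 2 ^+ 4 * (5 * x ^+ 4))%Z.
    have -> : 2 ^+ 4 * (5 * x ^+ 4) = u * v by rewrite muv; ring.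
    by rewrite dvdz_mull.
  rewrite prime_dvdzM // => /orP[/(prime_dvdzX _ _ _ pl)/(prime_dvdz_prime _ 2 pl isT) l2|].
    have := prime_dvd_odd _ _ _ luv (etrans (esym euv) ouv).
    by rewrite l2 eqxx.
  rewrite prime_dvdzM // => /orP[/(prime_dvdz_prime _ 5 pl isT) l5|/(prime_dvdzX _ _ _ pl)//].
  (* If 5 divides both u and v, then 25 divides 80 x^4, so 5 divides x. *)
  move: lu lv; rewrite l5 => /dvdzP[u' eu] /dvdzP[v' ev].
  have : (5%:Z %| 2 ^+ 4 * x ^+ 4)%Z.
    have -> : 2 ^+ 4 * x ^+ 4 = u' * v' * 5%:Z.
      apply: (@mulfI _ (5 : int)) => //.
      have -> : 5 * (2 ^+ 4 * x ^+ 4) = u * v by rewrite muv; ring.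
      by rewrite eu ev; ring.
    by rewrite dvdz_mull.
  by rewrite prime_dvdzM // => /orP[|/(prime_dvdzX 5 _ _ isT)].
clearbody u v.
wlog [kv ekv] : u v euv muv v0 u0 ouv cuv / exists kv, v = 2 * kv + 1.
  move=> wl; have [[kv ekv]|] := parityz v; last exact: (wl u v).
  apply: (wl v u) => //; do ?by [rewrite addrC | rewrite mulrC | rewrite coprimez_sym].
  by exists (4 * j + 9 * x ^+ 2 - kv); move: ouv; rewrite ekv; move: (x ^+ 2); clear; lia.
have [u' eu] : exists u', u = 16 * u'.
  have : (16%:Z %| u * v)%Z.
    by rewrite muv; apply/dvdzP; exists (5 * x ^+ 4); ring.
  have c16 : coprimez 16%:Z v.
    apply/coprimez_primeP => l pl l8 lv.
    have := prime_dvdzX l 4 2 pl l8 => /(prime_dvdz_prime _ 2 pl isT) l2.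
    by have := prime_dvd_odd _ _ _ lv ekv; rewrite l2 eqxx.
  by rewrite (Gauss_dvdzl _ c16) => /dvdzP[u' ->]; exists u'; rewrite mulrC.
have u'0 : 0 <= u' by move: u0; rewrite eu pmulr_rge0.
have cu' : coprimez u' v by move: cuv; rewrite eu coprimezMl => /andP[].
have mu' : u' * v = 5 * x ^+ 4.
  apply: (@mulfI _ (16 : int)) => //.
  have -> : 16 * (5 * x ^+ 4) = u * v by rewrite muv; ring.
  by rewrite eu; ring.
have ey2 : y ^+ 2 = 16 * u' + v - 18 * x ^+ 2 by rewrite -eu euv; ring.
have odd4 (z : int) (w : int) : 2 * kv + 1 = 2 * w + z ^+ 4 -> exists k, z = 2 * k + 1.
  move=> ez; have [kz ekz] : exists k, z ^+ 2 = 2 * k + 1.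
    by apply: (odd_of_square _ (kv - w)); rewrite mulrBr addrAC ez; ring.
  exact: odd_of_square ekz.
have : (5%:Z %| u' * v)%Z by rewrite mu' dvdz_mulr.
rewrite prime_dvdzM // => /orP[] /dvdzP[z ez].
  have z0 : 0 <= z by move: u'0; rewrite ez pmulr_lge0.
  have cz : coprimez z v by move: cu'; rewrite ez coprimezMl => /andP[].
  have mz : z * v = x ^+ 4.
    by apply: (@mulfI _ (5 : int)) => //; rewrite -mu' ez; ring.
  have [a [b [cab ea eb exab]]] := coprimez_fourth _ _ _ cz z0 v0 mz.
  exists a, b; split=> //; first by apply: (odd4 _ 0); rewrite mulr0 add0r -eb.
  by rewrite ey2 ez ea eb exab; ring.
have z0 : 0 <= z by move: v0; rewrite ez pmulr_lge0.
have cz : coprimez u' z by move: cu'; rewrite ez coprimezMr => /andP[].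
have mz : u' * z = x ^+ 4.
  by apply: (@mulfI _ (5 : int)) => //; rewrite -mu' ez; ring.
have [a [b [cab ea eb exab]]] := coprimez_fourth _ _ _ cz u'0 z0 mz.
have ob : exists k, b = 2 * k + 1.
  by apply: (odd4 _ (2 * b ^+ 4)); rewrite -ekv ez eb; ring.
exfalso; apply: (concordant_split a b y ob cab).
by rewrite ey2 ez ea eb exab; ring.
Qed.

(* Infinite descent: parametrizing the first equation by b = 2 x^2 + y^2, a = 2xy
   turns the second one into 4 x^4 + 36 x^2 y^2 + y^4 = r^2, and factoring that
   one gives a solution of the same system with smaller a. *)
Lemma concordant (b a s r : int) : coprimez b a -> (exists k, b = 2 * k + 1) ->
  b ^+ 2 - 2 * a ^+ 2 = s ^+ 2 -> b ^+ 2 + 8 * a ^+ 2 = r ^+ 2 -> a = 0.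
Proof.
have [N] := ubnP `|a|%N; elim: N => // N IHN in b a s r *.
move=> aN cba [k ek] es er.
wlog b0 : b k ek es er cba / 0 <= b.
  move=> wl; have [|blt] := leP 0 b; first exact: (wl b k).
  apply: (wl (- b) (- k - 1)); rewrite ?sqrrN //.
  - by rewrite ek; ring.
  - by rewrite coprimez_sym coprimezN coprimez_sym.
  - by rewrite oppr_ge0 ltW.
have [i hi] := odd_square_mod8 _ _ ek.
have [c ec] : exists c, s = 2 * c + 1.
  by apply: (odd_of_square _ (4 * i - a ^+ 2)); rewrite -es hi; ring.
have [g eg] : exists g, a = 2 * g.
  have [//|[ka eka]] := parityz a.
  have [ja hja] := odd_square_mod8 _ _ eka; have [js hjs] := odd_square_mod8 _ _ ec.
  by move: es; rewrite hja hjs hi; clear; lia.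
have sb : `|s| <= b.
  rewrite -ler_sqr ?nnegrE // real_normK ?num_real // -es.
  by rewrite gerBl mulr_ge0 ?sqr_ge0.
(* These are (b - s) / 2 and (b + s) / 2, with product a^2 / 2 and sum b. *)
pose m := k - c; pose n := k + c + 1.
have [m0 n0] : 0 <= m /\ 0 <= n.
  by move: sb; rewrite /m /n ek ec; clear; lia.
have mn : m * n = 2 * g ^+ 2.
  apply: (@mulfI _ (4 : int)) => //.
  have -> : 4 * (m * n) = b ^+ 2 - s ^+ 2 by rewrite ek ec /m /n; ring.
  by rewrite -es eg; ring.
have emn : m + n = b by rewrite ek /m /n; ring.
have cmn : coprimez m n.
  apply/coprimez_primeP => l pl lm ln.
  have lb : (l%:Z %| b)%Z by rewrite -emn rpredD.
  have : (l%:Z %| 2 * g ^+ 2)%Z by rewrite -mn dvdz_mull.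
  rewrite prime_dvdzM // => /orP[/(prime_dvdz_prime _ 2 pl isT) l2'|/(prime_dvdzX _ _ _ pl) lg].
    by have := prime_dvd_odd _ _ _ lb ek; rewrite l2' eqxx.
  by apply: (elimT (coprimez_primeP b a) cba l pl lb); rewrite eg dvdz_mull.
clearbody m n.
wlog [n' en] : m n m0 n0 mn emn cmn / exists n', n = 2 * n' + 1.
  move=> wl; have [[n' en]|] := parityz n; last exact: (wl m n).
  apply: (wl n m) => //; do ?by [rewrite addrC | rewrite mulrC | rewrite coprimez_sym].
  by exists (k - n'); move: emn; rewrite en ek; clear; lia.
have [m' em] : exists m', m = 2 * m'.
  by exists (k - n'); move: emn; rewrite en ek; clear; lia.
have m'0 : 0 <= m' by move: m0; rewrite em pmulr_rge0.
have mn' : m' * n = g ^+ 2 by apply: (@mulfI _ (2 : int)) => //; rewrite -mn em; ring.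
have cmn' : coprimez m' n by move: cmn; rewrite em coprimezMl => /andP[].
have [x ex] := coprimez_square _ _ _ cmn' m'0 mn'.
have [y ey] : exists y, n = y ^+ 2.
  by apply: (coprimez_square _ m' g); rewrite // 1?coprimez_sym 1?mulrC.
have cxy : coprimez x y by move: cmn'; rewrite ex ey coprimez_pexpl // coprimez_pexpr.
have [ky eky] : exists k, y = 2 * k + 1 by apply: (odd_of_square _ n'); rewrite -ey.
have gxy : g ^+ 2 = x ^+ 2 * y ^+ 2 by rewrite -mn' ex ey.
have er' : 4 * x ^+ 4 + 36 * x ^+ 2 * y ^+ 2 + y ^+ 4 = r ^+ 2.
  rewrite -er -emn em ex ey eg exprMn gxy; ring.
have [a' [b' [cab' ob' xab step]]] := concordant_factor _ _ _ cxy (ex_intro _ _ eky) er'.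
have [j [t [cja oj ejt ejb]]] := concordant_step x y a' b' cab' ob' (ex_intro _ _ eky) step.
have [a0|na0] := eqVneq a' 0.
  apply/eqP; rewrite -sqrf_eq0 eg exprMn gxy xab a0; apply/eqP; ring.
suff a'0 : a' = 0 by rewrite a'0 eqxx in na0.
apply: (IHN j a' t b') => //.
(* a^2 = 4 x^2 y^2 = 4 a'^2 b'^2 y^2 exceeds a'^2 since b' and y are odd. *)
have : `|a'| < `|a|; last by move: aN; clear; lia.
rewrite -ltr_sqr ?nnegrE // !real_normK ?num_real //.
rewrite eg exprMn gxy xab.
have [kb ekb] := ob'.
have p1 : 1 <= b' ^+ 2 * y ^+ 2.
  by rewrite mulr_ege1 ?(odd_square_ge1 _ _ ekb) ?(odd_square_ge1 _ _ eky).
have a1 : 0 < a' ^+ 2 by rewrite lt0r sqrf_eq0 na0 sqr_ge0.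
have := ler_peMr (ltW a1) p1; rewrite mulrA.
by move: a1; move: (a' ^+ 2) (_ * _ * _) => A B; clear; lia.
Qed.

(** The factors differ by 10 x^2; a common factor 5 is excluded because 2 is not a square modulo 5.
    The first is positive and p is odd, so both are squares, which is the system of [concordant]. *)
Lemma quartic_m12_100_pos (x y p : int) : coprimez x y -> (exists k, y = 2 * k + 1) ->
  (exists k, p = 2 * k + 1) ->
  p ^+ 2 = (y ^+ 2 + 8 * x ^+ 2) * (y ^+ 2 - 2 * x ^+ 2) -> x = 0.
Proof.
move=> cxy [k ek] [kp ekp] e.
have [i hi] := odd_square_mod8 _ _ ek.
have cf : coprimez (y ^+ 2 + 8 * x ^+ 2) (y ^+ 2 - 2 * x ^+ 2).
  apply/coprimez_primeP => l pl l1 l2.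
  have : (l%:Z %| 2 * (5 * x ^+ 2))%Z.
    have -> : 2 * (5 * x ^+ 2) = (y ^+ 2 + 8 * x ^+ 2) - (y ^+ 2 - 2 * x ^+ 2) by ring.
    by rewrite rpredB.
  rewrite prime_dvdzM // => /orP[/(prime_dvdz_prime _ 2 pl isT) l2'|].
    have o : y ^+ 2 + 8 * x ^+ 2 = 2 * (4 * i + 4 * x ^+ 2) + 1 by rewrite hi; ring.
    by have := prime_dvd_odd _ _ _ l1 o; rewrite l2' eqxx.
  rewrite prime_dvdzM // => /orP[/(prime_dvdz_prime _ 5 pl isT) l5|/(prime_dvdzX _ _ _ pl) lx].
    have [ly lx] : (5%:Z %| y)%Z /\ (5%:Z %| x)%Z.
      by apply: (dvd5_form y x true); rewrite expr1 -mulrA mulN1r -l5.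
    exact: (elimT (coprimez_primeP x y) cxy 5%N isT lx ly).
  apply: (elimT (coprimez_primeP x y) cxy l pl lx); apply: (prime_dvdzX l 2) => //.
  have -> : y ^+ 2 = (y ^+ 2 - 2 * x ^+ 2) + 2 * x * x by ring.
  by rewrite rpredD // dvdz_mull.
have [[r hr] [s hs]] := coprimez_pm_square _ _ cf (ex_intro _ p (or_introl (esym e))).
have er : y ^+ 2 + 8 * x ^+ 2 = r ^+ 2.
  case: hr => // ; have := sqr_ge0 r; have := sqr_ge0 x; have := sqr_ge0 y; rewrite hi.
  by move: (x ^+ 2) (r ^+ 2) => X R; clear; lia.
have es : y ^+ 2 - 2 * x ^+ 2 = s ^+ 2.
  case: hs => // hs.
  have y1 : p ^+ 2 + (r * s) ^+ 2 = 0 by rewrite e er hs; ring.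
  have := odd_square_ge1 _ _ ekp; have := sqr_ge0 (r * s); move: y1.
  by move: (p ^+ 2) ((r * s) ^+ 2) => P A; clear; lia.
by apply: (concordant y x s r) => //; [rewrite coprimez_sym | exists k].
Qed.

(** By coprimality 8 x^2 - y^2 is a square up to sign; being 7 modulo 8 it is not a square, and
    minus a square would contradict p^2 > 0. *)
Lemma quartic_m12_100_neg (x y p : int) : coprimez x y -> (exists k, y = 2 * k + 1) ->
  (exists k, p = 2 * k + 1) ->
  p ^+ 2 = (8 * x ^+ 2 - y ^+ 2) * (2 * x ^+ 2 + y ^+ 2) -> False.
Proof.
move=> cxy [k ek] [kp ekp] e.
have [i hi] := odd_square_mod8 _ _ ek.
have cf : coprimez (8 * x ^+ 2 - y ^+ 2) (2 * x ^+ 2 + y ^+ 2).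
  apply/coprimez_primeP => l pl l1 l2.
  have : (l%:Z %| 5 * y ^+ 2)%Z.
    have -> : 5 * y ^+ 2 = 4 * (2 * x ^+ 2 + y ^+ 2) - (8 * x ^+ 2 - y ^+ 2) by ring.
    by rewrite rpredB // dvdz_mull.
  rewrite prime_dvdzM // => /orP[/(prime_dvdz_prime _ 5 pl isT) l5|/(prime_dvdzX _ _ _ pl) ly].
    have [ly lx] : (5%:Z %| y)%Z /\ (5%:Z %| x)%Z.
      by apply: (dvd5_form y x false); rewrite expr0 mul1r addrC -l5.
    exact: (elimT (coprimez_primeP x y) cxy 5%N isT lx ly).
  have : (l%:Z %| 2 * x ^+ 2)%Z.
    have -> : 2 * x ^+ 2 = (2 * x ^+ 2 + y ^+ 2) - y * y by ring.
    by rewrite rpredB // dvdz_mull.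
  rewrite prime_dvdzM // => /orP[/(prime_dvdz_prime _ 2 pl isT) l2'|/(prime_dvdzX _ _ _ pl) lx].
    by have := prime_dvd_odd _ _ _ ly ek; rewrite l2' eqxx.
  exact: (elimT (coprimez_primeP x y) cxy l pl lx ly).
have [[r hr] _] := coprimez_pm_square _ _ cf (ex_intro _ p (or_introl (esym e))).
have [t ht] := square_mod8 r.
have q0 : 0 <= r ^+ 2 * (2 * x ^+ 2 + y ^+ 2).
  by rewrite mulr_ge0 ?sqr_ge0 // addr_ge0 ?sqr_ge0 // mulr_ge0 ?sqr_ge0.
case: hr => hr.
  move: hr; rewrite hi; move: ht; move: (x ^+ 2) (r ^+ 2) => X R.
  by case=> ->; clear; lia.
have := odd_square_ge1 _ _ ekp; rewrite e hr mulNr.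
by move: q0; move: (r ^+ 2 * _) => Q; clear; lia.
Qed.

(** As w^2 - (p^2 - 6 q^2)^2 = 64 q^4, the numbers u, v = (w -+ (p^2 - 6 q^2)) / 2 are coprime with
    product 16 q^4. Now p^2 is recovered from the difference v - u, so the two parities differ: v
    odd leads to [quartic_m12_100_pos], u odd to the impossible [quartic_m12_100_neg]. *)
Lemma quartic_m12_100 (p q w : int) : coprimez p q -> (exists k, p = 2 * k + 1) ->
  p ^+ 4 - 12 * p ^+ 2 * q ^+ 2 + 100 * q ^+ 4 = w ^+ 2 -> q = 0.
Proof.
move=> cpq op e; have [k ek] := op.
wlog w0 : w e / 0 <= w.
  move=> wl; have [|wlt] := leP 0 w; first exact: wl.
  by apply: (wl (- w)); rewrite ?sqrrN // oppr_ge0 ltW.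
have [j hj] := odd_square_mod8 _ _ ek.
have [c ec] : exists c, w = 2 * c + 1.
  apply: (odd_of_square _ (32 * j ^+ 2 + 8 * j - 6 * p ^+ 2 * q ^+ 2 + 50 * q ^+ 4)).
  rewrite -e; have -> : p ^+ 4 = (8 * j + 1) ^+ 2 by rewrite -hj; ring.
  by ring.
pose d := 4 * j - 3 * q ^+ 2.
have hd : p ^+ 2 - 6 * q ^+ 2 = 2 * d + 1 by rewrite hj /d; ring.
pose u := c - d; pose v := c + d + 1.
have euv : v - u = p ^+ 2 - 6 * q ^+ 2 by rewrite hd /u /v; ring.
have muv : u * v = 16 * q ^+ 4.
  apply: (@mulfI _ (4 : int)) => //.
  have -> : 4 * (u * v) = w ^+ 2 - (p ^+ 2 - 6 * q ^+ 2) ^+ 2.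
    by rewrite hd ec /u /v; ring.
  by rewrite -e; ring.
have [u0 v0] : 0 <= u /\ 0 <= v.
  apply: ge0_pair.
    by rewrite muv mulr_ge0 // -[4%N]/(2 * 2)%N exprM sqr_ge0.
  have -> : u + v = w by rewrite ec /u /v; ring.
  by [].
have cuv : coprimez u v.
  apply/coprimez_primeP => l pl lu lv.
  have luv : (l%:Z %| p ^+ 2 - 6 * q ^+ 2)%Z by rewrite -euv rpredB.
  have : (l%:Z %| 2 ^+ 4 * q ^+ 4)%Z.
    have -> : 2 ^+ 4 * q ^+ 4 = u * v by rewrite muv; ring.
    by rewrite dvdz_mull.
  rewrite prime_dvdzM // => /orP[/(prime_dvdzX _ _ _ pl)/(prime_dvdz_prime _ 2 pl isT) l2|].
    by have := prime_dvd_odd _ _ _ luv hd; rewrite l2 eqxx.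
  move/(prime_dvdzX _ _ _ pl) => lq.
  apply: (elimT (coprimez_primeP p q) cpq l pl _ lq); apply: (prime_dvdzX l 2) => //.
  have -> : p ^+ 2 = (p ^+ 2 - 6 * q ^+ 2) + 6 * q * q by ring.
  by rewrite rpredD // dvdz_mull.
have ouv : v = u + 2 * d + 1 by rewrite /u /v; ring.
clearbody u v d.
have split16 (a b : int) : coprimez a b -> 0 <= a -> 0 <= b -> a * b = 16 * q ^+ 4 ->
    (exists kb, b = 2 * kb + 1) ->
    exists x y, [/\ coprimez x y, exists ky, y = 2 * ky + 1, a = 16 * x ^+ 4,
      b = y ^+ 4 & q ^+ 2 = x ^+ 2 * y ^+ 2].
  move=> cab a0 b0 mab [kb ekb].
  have [a' ea] : exists a', a = 16 * a'.
    have : (16%:Z %| a * b)%Z by rewrite mab dvdz_mulr.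
    have c16 : coprimez 16%:Z b.
      apply/coprimez_primeP => l pl l8 lb.
      have := prime_dvdzX l 4 2 pl l8 => /(prime_dvdz_prime _ 2 pl isT) l2.
      by have := prime_dvd_odd _ _ _ lb ekb; rewrite l2 eqxx.
    by rewrite (Gauss_dvdzl _ c16) => /dvdzP[a' ->]; exists a'; rewrite mulrC.
  have a'0 : 0 <= a' by move: a0; rewrite ea pmulr_rge0.
  have ca' : coprimez a' b by move: cab; rewrite ea coprimezMl => /andP[].
  have mab' : a' * b = q ^+ 4.
    by apply: (@mulfI _ (16 : int)) => //; rewrite -mab ea; ring.
  have [x [y [cxy ex ey exy]]] := coprimez_fourth _ _ _ ca' a'0 b0 mab'.
  exists x, y; split=> //; last by rewrite ea ex.
  have [ky2 eky2] : exists k, y ^+ 2 = 2 * k + 1.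
    by apply: (odd_of_square _ kb); rewrite -ekb ey; ring.
  exact: odd_of_square eky2.
have [[ku eku]|ou] := parityz u.
  have ov : exists kv, v = 2 * kv + 1 by exists (ku + d); rewrite ouv eku; ring.
  have [x [y [cxy oy ex ey exy]]] := split16 u v cuv u0 v0 muv ov.
  have x0 : x = 0.
    apply: (quartic_m12_100_pos x y p) => //.
    have -> : p ^+ 2 = (v - u) + 6 * q ^+ 2 by rewrite euv; ring.
    by rewrite ex ey exy; ring.
  by apply/eqP; rewrite -sqrf_eq0 exy x0 expr0n mul0r.
rewrite coprimez_sym in cuv; rewrite mulrC in muv.
have [x [y [cxy oy ex ey exy]]] := split16 v u cuv v0 u0 muv ou.
exfalso; apply: (quartic_m12_100_neg x y p cxy oy op).
have -> : p ^+ 2 = (v - u) + 6 * q ^+ 2 by rewrite euv; ring.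
by rewrite ex ey exy; ring.
Qed.

(** * Rational points on the quartics *)

Lemma rat_square_int (x : rat) (n : int) : x ^+ 2 = n%:~R -> exists m, n = m ^+ 2.
Proof.
move=> e; have d0 : denq x != 0 := denq_neq0 x.
have {}e : numq x ^+ 2 = n * denq x ^+ 2.
  apply/eqP; rewrite -(eqr_int rat) rmorphXn rmorphM rmorphXn /= -e -[in x ^+ 2](divq_num_den x).
  by rewrite expr_div_n divfK // expf_eq0 /= intr_eq0.
have c : coprimez (denq x ^+ 2) (numq x ^+ 2).
  by rewrite coprimez_pexpl // coprimez_pexpr // coprimez_sym; exact: coprime_num_den.
have : (denq x ^+ 2 %| 1)%Z.
  by rewrite -(Gauss_dvdzr _ c) mulr1 e dvdz_mull.
rewrite dvdz1 abszX -mulnn muln_eq1 andbb => /eqP d1.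
have dd : denq x = 1 by rewrite -absz_denq d1.
by exists (numq x); rewrite e dd expr1n mulr1.
Qed.

Lemma rat_quartic (A B C : int) (t w : rat) :
  A%:~R * t ^+ 4 + B%:~R * t ^+ 2 + C%:~R = w ^+ 2 -> exists m,
  A * numq t ^+ 4 + B * numq t ^+ 2 * denq t ^+ 2 + C * denq t ^+ 4 = m ^+ 2.
Proof.
move=> e; have d0 : (denq t)%:~R != 0 :> rat by rewrite intr_eq0 denq_neq0.
apply: (rat_square_int (w * (denq t)%:~R ^+ 2)); rewrite exprMn -e.
have := divq_num_den t; move: (numq t) (denq t) d0 => n d d0 <-.
by rewrite !(rmorphXn, rmorphD, rmorphM) /=; field.
Qed.

Lemma coprimez_num_den (t : rat) : coprimez (numq t) (denq t).
Proof. exact: coprime_num_den. Qed.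

Lemma nonsquare_2mod8 (n m : int) : 8 * n + 2 <> m ^+ 2.
Proof. by have [j] := square_mod8 m => -[] ->; lia. Qed.

(** For t = p / q in lowest terms, the left side times q^4 has odd 2-adic valuation: 1 if p is odd,
    3 if p is even, since q is then odd. *)
Lemma two_quartic_nonsquare (a b : int) (t w : rat) :
  2 * (t ^+ 4 + 4 * a%:~R * t ^+ 2 + 4 * (2 * b%:~R + 1)) <> w ^+ 2.
Proof.
move=> e; have [m] : exists m, 2 * numq t ^+ 4 + (8 * a) * numq t ^+ 2 * denq t ^+ 2
    + (8 * (2 * b + 1)) * denq t ^+ 4 = m ^+ 2.
  apply: (rat_quartic _ _ _ t w); rewrite -e !(rmorphD, rmorphM) /=; ring.
have := coprimez_num_den t; move: (numq t) (denq t) => p q cpq {}e.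
have [[p' ep]|[k ek]] := parityz p; last first.
  have [j hj] := odd_square_mod8 _ _ ek.
  apply: (nonsquare_2mod8
    (2 * (8 * j ^+ 2 + 2 * j) + a * p ^+ 2 * q ^+ 2 + (2 * b + 1) * q ^+ 4) m).
  rewrite -e; have -> : p ^+ 4 = (8 * j + 1) ^+ 2 by rewrite -hj; ring.
  by rewrite -!mulrA; move: (p ^+ 2 * q ^+ 2) (q ^+ 4) => X Y; ring.
have [[q' eq]|[k ek]] := parityz q.
  by have := elimT (coprimez_primeP p q) cpq 2%N isT; rewrite ep eq !dvdz_mulr //; apply.
have [j hj] := odd_square_mod8 _ _ ek.
have [[m' em]|[km ekm]] := parityz m; last first.
  have [jm hjm] := odd_square_mod8 _ _ ekm; move: e; rewrite hjm => e.
  have : 2 * (p ^+ 4 + 4 * a * p ^+ 2 * q ^+ 2 + 4 * (2 * b + 1) * q ^+ 4) = 8 * jm + 1.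
    by rewrite -e; ring.
  by move: (_ + _ + _) => X; clear; lia.
have [[m2 em2]|[km ekm]] := parityz m'; last first.
  have [jm hjm] := odd_square_mod8 _ _ ekm.
  have : 8 * (4 * p' ^+ 4 + 4 * a * p' ^+ 2 * q ^+ 2 + (2 * b + 1) * q ^+ 4) = 4 * (8 * jm + 1).
    by rewrite -hjm; have -> : 4 * m' ^+ 2 = m ^+ 2 by [rewrite em; ring]; rewrite -e ep; ring.
  by move: (4 * _ ^+ 4 + _ + _) => X; clear; lia.
have : 8 * (2 * (2 * p' ^+ 4 + 2 * a * p' ^+ 2 * q ^+ 2 + b * (8 * j + 1) ^+ 2
    + 32 * j ^+ 2 + 8 * j) + 1) = 16 * m2 ^+ 2.
  have -> : 16 * m2 ^+ 2 = m ^+ 2 by rewrite em em2; ring.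
  rewrite -e ep; have -> : q ^+ 4 = (8 * j + 1) ^+ 2 by rewrite -hj; ring.
  by ring.
by move: (_ + 8 * j) (m2 ^+ 2) => X Y; clear; lia.
Qed.

(** [quartic12_4] wants an odd numerator. If p = 2 p', dividing by 4 gives the same form with q and
    p' as arguments; this is the symmetry r -> 2 / r. *)
Lemma rat_quartic12_4 (r w : rat) : r ^+ 4 + 12 * r ^+ 2 + 4 = w ^+ 2 -> r = 0.
Proof.
move=> e; have [m {}e] : exists m, 1 * numq r ^+ 4 + 12 * numq r ^+ 2 * denq r ^+ 2
    + 4 * denq r ^+ 4 = m ^+ 2.
  by apply: (rat_quartic _ _ _ r w); rewrite -e mul1r.
have := coprimez_num_den r; have := denq_neq0 r.
have -> : (r = 0) <-> (numq r = 0).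
  by split=> [->|/eqP]; rewrite ?numq_eq0 // => /eqP.
move: e; move: (numq r) (denq r) => p q e q0 cpq.
have [[p' ep]|op] := parityz p; last first.
  by case/eqP: q0; apply: (quartic12_4 p q m) => //; rewrite -e; ring.
have oq : exists k, q = 2 * k + 1.
  have [[q' eq]|//] := parityz q.
  by have := elimT (coprimez_primeP p q) cpq 2%N isT; rewrite ep eq !dvdz_mulr //; case.
have [[m' em]|[km ekm]] := parityz m; last first.
  have [jm hjm] := odd_square_mod8 _ _ ekm; move: e; rewrite hjm => e.
  have : 4 * (4 * p' ^+ 4 + 12 * p' ^+ 2 * q ^+ 2 + q ^+ 4) = 8 * jm + 1.
    by rewrite -e ep; ring.
  by move: (_ + _ + _) => X; clear; lia.
rewrite ep (quartic12_4 q p' m') ?mulr0 // 1?coprimez_sym.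
  by move: cpq; rewrite ep coprimezMl => /andP[].
apply: (@mulfI _ (4 : int)) => //.
have -> : 4 * m' ^+ 2 = m ^+ 2 by rewrite em; ring.
by rewrite -e ep; ring.
Qed.

Lemma rat_quartic_m12_100 (t w : rat) : t ^+ 4 - 12 * t ^+ 2 + 100 = w ^+ 2 -> t = 0.
Proof.
move=> e; apply/eqP/negPn/negP => t0.
have odd_case (x v : rat) : x ^+ 4 - 12 * x ^+ 2 + 100 = v ^+ 2 ->
    ~ exists k, numq x = 2 * k + 1.
  move=> {}e on; have [m em] : exists m, 1 * numq x ^+ 4 + (- 12) * numq x ^+ 2 * denq x ^+ 2
      + 100 * denq x ^+ 4 = m ^+ 2.
    by apply: (rat_quartic _ _ _ x v); rewrite -e mul1r -mulNr.
  have := quartic_m12_100 (numq x) (denq x) m (coprimez_num_den x) on.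
  by rewrite -em mul1r !mulNr => /(_ erefl)/eqP; rewrite denq_eq0.
have [[p' ep]|] := parityz (numq t); last exact: odd_case e.
have oq : exists k, denq t = 2 * k + 1.
  have [[q' eq]|//] := parityz (denq t).
  by have := elimT (coprimez_primeP _ _) (coprimez_num_den t) 2%N isT; rewrite ep eq !dvdz_mulr //; case.
(* The substitution t -> 10 / t multiplies the quartic by the square (10 / t^2)^2. The numerators of
   t and 10 / t are not both even: their product is 10 times that of the denominators, which would
   both be odd. *)
pose x := 10 / t.
have ex : x ^+ 4 - 12 * x ^+ 2 + 100 = (10 * w / t ^+ 2) ^+ 2.
  have -> : (10 * w / t ^+ 2) ^+ 2 = 100 / t ^+ 4 * w ^+ 2 by field.
  by rewrite -e /x; field.
apply: (odd_case x _ ex).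
have [[n en]|//] := parityz (numq x); exfalso.
have [[d ed]|[kd ekd]] := parityz (denq x).
  by have := elimT (coprimez_primeP _ _) (coprimez_num_den x) 2%N isT; rewrite en ed !dvdz_mulr //; case.
have [kt ekt] := oq.
have : numq x * numq t = 10 * (denq t * denq x).
  apply/eqP; rewrite -(eqr_int rat) !rmorphM /=; apply/eqP.
  have xd : (denq x)%:~R != 0 :> rat by rewrite intr_eq0 denq_neq0.
  have td : (denq t)%:~R != 0 :> rat by rewrite intr_eq0 denq_neq0.
  have -> : (numq x)%:~R = x * (denq x)%:~R :> rat by rewrite -{2}(divq_num_den x) divfK.
  have -> : (numq t)%:~R = t * (denq t)%:~R :> rat by rewrite -{2}(divq_num_den t) divfK.
  by rewrite /x; field.
rewrite en ep ekt ekd.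
have -> : (2 * kt + 1) * (2 * kd + 1) = 2 * (2 * kt * kd + kt + kd) + 1 by ring.
have -> : 2 * n * (2 * p') = 4 * (n * p') by ring.
by move: (n * p') (_ + kd) => X Y; clear; lia.
Qed.

(** * The group law *)

Section ChordTangent.
Variable p : {poly rat}.
Hypotheses (mon_p : p \is monic) (size_p : size p = 4%N).

Lemma horner_cubic x : p.[x] = x ^+ 3 + p`_2 * x ^+ 2 + p`_1 * x + p`_0.
Proof.
have p3 : p`_3 = 1 by move/monicP: mon_p; rewrite lead_coefE size_p.
rewrite horner_coef size_p !big_ord_recl big_ord0 /= /bump /= p3; ring.
Qed.

Lemma horner_deriv_cubic x : p^`().[x] = 3 * x ^+ 2 + 2 * p`_2 * x + p`_1.
Proof.
have p3 : p`_3 = 1 by move/monicP: mon_p; rewrite lead_coefE size_p.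
have sz : (size p^`() <= 3)%N by rewrite -ltnS -size_p lt_size_deriv ?monic_neq0.
rewrite (horner_coef_wide _ sz) !big_ord_recl big_ord0 /= /bump /= !coef_deriv p3; ring.
Qed.

Definition pt_slope (x1 y1 x2 y2 : rat) : rat :=
  if x1 == x2 then p^`().[x1] / (2 * y1) else (y2 - y1) / (x2 - x1).

(** A division-free description that treats chord and tangent together: for x1 = x2 the first clause
    forces y1 = y2 and the second concerns the slope; otherwise the second is vacuous. *)
Definition is_slope (l x1 y1 x2 y2 : rat) : Prop :=
  y2 = y1 + l * (x2 - x1) /\ (x1 = x2 -> p^`().[x1] = 2 * l * y1).

Definition opposite (x1 y1 x2 y2 : rat) : bool := (x1 == x2) && (y1 == - y2).

Lemma opposite_sym x1 y1 x2 y2 : opposite x1 y1 x2 y2 = opposite x2 y2 x1 y1.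
Proof. by rewrite /opposite eq_sym [y2 == _]eq_sym eqr_oppLR. Qed.

Lemma non_opposite x1 y1 x2 y2 :
  y1 ^+ 2 = p.[x1] -> y2 ^+ 2 = p.[x2] -> ~~ opposite x1 y1 x2 y2 ->
  x1 = x2 -> y1 = y2 /\ y1 != 0.
Proof.
move=> h1 h2 nopp e12; move: nopp; rewrite /opposite e12 eqxx /= => yN.
have /eqP : y1 ^+ 2 = y2 ^+ 2 by rewrite h1 h2 e12.
rewrite eqf_sqr (negPf yN) orbF => /eqP e; split=> //.
by apply: contra yN; rewrite -e => /eqP->; rewrite oppr0.
Qed.

Lemma pt_slopeP x1 y1 x2 y2 :
  y1 ^+ 2 = p.[x1] -> y2 ^+ 2 = p.[x2] -> ~~ opposite x1 y1 x2 y2 ->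
  is_slope (pt_slope x1 y1 x2 y2) x1 y1 x2 y2.
Proof.
move=> h1 h2 nopp; rewrite /pt_slope; case: eqP => [e|/eqP ne].
  have [ey ny] := non_opposite _ _ _ _ h1 h2 nopp e.
  split; first by rewrite e ey; ring.
  by move=> _; field; rewrite ny.
split; last by move=> e; rewrite e eqxx in ne.
by field; rewrite subr_eq0 eq_sym.
Qed.

Lemma is_slope_uniq l x1 y1 x2 y2 :
  y1 ^+ 2 = p.[x1] -> y2 ^+ 2 = p.[x2] -> ~~ opposite x1 y1 x2 y2 ->
  is_slope l x1 y1 x2 y2 -> pt_slope x1 y1 x2 y2 = l.
Proof.
move=> h1 h2 nopp [ey hd]; rewrite /pt_slope; case: eqP => [e|/eqP ne].
  have [_ ny] := non_opposite _ _ _ _ h1 h2 nopp e.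
  by rewrite (hd e); field; rewrite ny.
by rewrite ey; field; rewrite subr_eq0 eq_sym.
Qed.

Lemma is_slope_sym l x1 y1 x2 y2 : ~~ opposite x1 y1 x2 y2 ->
  is_slope l x1 y1 x2 y2 -> is_slope l x2 y2 x1 y1.
Proof.
move=> nopp [ey hd]; split; first by rewrite ey; ring.
by move=> e; rewrite e hd // ey e; ring.
Qed.

Definition third (l x1 x2 : rat) : rat := l ^+ 2 - p`_2 - x1 - x2.

Lemma pt_add_slope l x1 y1 x2 y2 :
  y1 ^+ 2 = p.[x1] -> y2 ^+ 2 = p.[x2] -> ~~ opposite x1 y1 x2 y2 ->
  is_slope l x1 y1 x2 y2 ->
  pt_add p (Some (x1, y1)) (Some (x2, y2)) =
    Some (third l x1 x2, - (y1 + l * (third l x1 x2 - x1))).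
Proof.
move=> h1 h2 nopp hl; have := is_slope_uniq _ _ _ _ _ h1 h2 nopp hl.
by rewrite /pt_slope /pt_add -/(opposite _ _ _ _) (negPf nopp) => ->.
Qed.

Lemma pt_add_opposite x1 y1 x2 y2 : opposite x1 y1 x2 y2 ->
  pt_add p (Some (x1, y1)) (Some (x2, y2)) = None.
Proof. by rewrite /opposite /pt_add => ->. Qed.

(* The line y = l x + n meets the curve where p - (l x + n)^2 vanishes; compare
   coefficients with (x - x1)(x - x2)(x - x3). *)
Lemma chord_coefs l x1 y1 x2 y2 (n := y1 - l * x1) (x3 := third l x1 x2) :
  y1 ^+ 2 = p.[x1] -> y2 ^+ 2 = p.[x2] ->
  is_slope l x1 y1 x2 y2 ->
  p`_1 = 2 * l * n + x1 * x2 + (x1 + x2) * x3 /\ p`_0 = n ^+ 2 - x1 * x2 * x3.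
Proof.
move=> h1 h2 [ey hd].
have hB : p`_1 = 2 * l * n + x1 * x2 + (x1 + x2) * x3.
  have [e|ne] := eqVneq x1 x2.
    have := hd e; rewrite horner_deriv_cubic /n /x3 /third -e => h.
    have -> : p`_1 = (2 * l * y1) - (3 * x1 ^+ 2 + 2 * p`_2 * x1) by rewrite -h; ring.
    ring.
  have nz : x2 - x1 != 0 by rewrite subr_eq0 eq_sym.
  apply: (mulfI nz); rewrite /n /x3 /third.
  move: h1 h2; rewrite !horner_cubic ey => h1 h2.
  have -> : (x2 - x1) * p`_1 = (y1 + l * (x2 - x1)) ^+ 2 - y1 ^+ 2
      - (x2 ^+ 3 - x1 ^+ 3) - p`_2 * (x2 ^+ 2 - x1 ^+ 2) by rewrite h1 h2; ring.
  ring.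
split=> //.
have -> : p`_0 = y1 ^+ 2 - (x1 ^+ 3 + p`_2 * x1 ^+ 2 + p`_1 * x1).
  by rewrite h1 horner_cubic; ring.
rewrite hB /n /x3 /third; ring.
Qed.

Lemma chord_horner l x1 y1 x2 y2 x (x3 := third l x1 x2) :
  y1 ^+ 2 = p.[x1] -> y2 ^+ 2 = p.[x2] -> is_slope l x1 y1 x2 y2 ->
  p.[x] - (y1 + l * (x - x1)) ^+ 2 = (x - x1) * (x - x2) * (x - x3).
Proof.
move=> h1 h2 hl; have [hB hC] := chord_coefs _ _ _ _ _ h1 h2 hl.
rewrite horner_cubic hB hC /x3 /third; ring.
Qed.

Lemma chord_deriv l x1 y1 x2 y2 x (x3 := third l x1 x2) :
  y1 ^+ 2 = p.[x1] -> y2 ^+ 2 = p.[x2] -> is_slope l x1 y1 x2 y2 ->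
  p^`().[x] = 2 * l * (y1 + l * (x - x1)) + (x - x1) * (x - x2)
    + (x - x1) * (x - x3) + (x - x2) * (x - x3).
Proof.
move=> h1 h2 hl; have [hB _] := chord_coefs _ _ _ _ _ h1 h2 hl.
rewrite horner_deriv_cubic hB /x3 /third; ring.
Qed.

Lemma on_curve_add P Q : on_curve p P -> on_curve p Q -> on_curve p (pt_add p P Q).
Proof.
case: P => [[x1 y1]|] //; case: Q => [[x2 y2]|] // h1 h2.
have [opp|nopp] := boolP (opposite x1 y1 x2 y2); first by rewrite pt_add_opposite.
have hl := pt_slopeP _ _ _ _ h1 h2 nopp.
rewrite (pt_add_slope _ _ _ _ _ h1 h2 nopp hl) /=.
apply/eqP; rewrite -subr_eq0 -[_ - _]opprK opprB sqrrN.
by rewrite (chord_horner _ _ _ _ _ _ h1 h2 hl) subrr mulr0 oppr0.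
Qed.

Lemma on_curve_opp P : on_curve p P -> on_curve p (pt_opp P).
Proof. by case: P => [[x y]|] //= h; rewrite sqrrN. Qed.

Lemma pt_addC P Q : on_curve p P -> on_curve p Q -> pt_add p P Q = pt_add p Q P.
Proof.
case: P => [[x1 y1]|]; case: Q => [[x2 y2]|] //; rewrite /on_curve => h1 h2.
have [opp|nopp] := boolP (opposite x1 y1 x2 y2).
  by rewrite !pt_add_opposite // opposite_sym.
have hl := pt_slopeP _ _ _ _ h1 h2 nopp; set l := pt_slope _ _ _ _ in hl.
have hl' := is_slope_sym _ _ _ _ _ nopp hl.
rewrite (pt_add_slope _ _ _ _ _ h1 h2 nopp hl); rewrite opposite_sym in nopp.
rewrite (pt_add_slope _ _ _ _ _ h2 h1 nopp hl').
case: hl' => -> _; congr (Some (_, _)); rewrite /third; ring.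
Qed.

Lemma pt_addN P : pt_add p (pt_opp P) P = None.
Proof. by case: P => [[x y]|] //=; rewrite !eqxx. Qed.

Hypothesis nonsing : forall x, p.[x] = 0 -> p^`().[x] != 0.

(** Reflecting the chord through P and Q in the x-axis gives a line of slope -l through -P and P +
    Q. These two can only be opposite if y1 = 0 and p'(x1) = 0, which nonsingularity forbids. *)
Lemma pt_addKV P Q : on_curve p P -> on_curve p Q ->
  pt_add p (pt_opp P) (pt_add p P Q) = Q.
Proof.
case: P => [[x1 y1]|] //; case: Q => [[x2 y2]|]; last first.
  by move=> _ _; exact: (pt_addN (Some (x1, y1))).
rewrite /on_curve => h1 h2.
have [opp|nopp] := boolP (opposite x1 y1 x2 y2).
  rewrite pt_add_opposite //=.
  by case/andP: opp => /eqP-> /eqP->; rewrite opprK.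
have hl := pt_slopeP _ _ _ _ h1 h2 nopp; set l := pt_slope _ _ _ _ in hl.
have h3 := @on_curve_add (Some (x1, y1)) (Some (x2, y2)) h1 h2.
rewrite (pt_add_slope _ _ _ _ _ h1 h2 nopp hl) /on_curve in h3 *.
set x3 := third l x1 x2 in h3 *; set y3 := - (_ + _) in h3 *.
have hd : x1 = x3 -> p^`().[x1] = 2 * l * y1.
  by move=> e; rewrite (chord_deriv _ _ _ _ _ _ h1 h2 hl) -/x3 -e; ring.
have h1' : (- y1) ^+ 2 = p.[x1] by rewrite sqrrN.
have nopp' : ~~ opposite x1 (- y1) x3 y3.
  apply/negP => /andP[/eqP e]; rewrite /y3 -e subrr mulr0 addr0 opprK => /eqP ey.
  have y0 : y1 = 0 by lra.
  have := nonsing x1; rewrite -h1 (hd e) y0 mulr0 eqxx expr0n => h.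
  by have := h erefl.
have hl' : is_slope (- l) x1 (- y1) x3 y3.
  by split=> [|e]; [rewrite /y3; ring | rewrite hd //; ring].
rewrite (pt_add_slope _ _ _ _ _ h1' h3 nopp' hl').
case: hl => ey _; rewrite ey; congr Some; rewrite /x3 /third; congr pair; ring.
Qed.

(* If d is the second divided difference at P, Q, R of y as a function of x on
   the curve, then the line through P + Q and R has slope 1 / d - l. *)
Lemma pt_add_add l d x1 y1 x2 y2 x y (x3 := third l x1 x2)
    (n := y1 + l * (x - x1)) :
  y1 ^+ 2 = p.[x1] -> y2 ^+ 2 = p.[x2] -> y ^+ 2 = p.[x] ->
  ~~ opposite x1 y1 x2 y2 -> is_slope l x1 y1 x2 y2 ->
  y - n = d * (x - x1) * (x - x2) -> x - x3 = d * (y + n) ->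
  (d != 0 -> y = 0 -> n <> 0) ->
  pt_add p (pt_add p (Some (x1, y1)) (Some (x2, y2))) (Some (x, y)) =
    if d == 0 then None else
    let x4 := (d^-1 - l) ^+ 2 - p`_2 - x3 - x in
    Some (x4, - (y + (d^-1 - l) * (x4 - x))).
Proof.
move=> h1 h2 h nopp hl e1 e2 hn.
have h3 := @on_curve_add (Some (x1, y1)) (Some (x2, y2)) h1 h2.
rewrite (pt_add_slope _ _ _ _ _ h1 h2 nopp hl) /on_curve in h3 *.
rewrite -/x3 in h3 *.
have [d0|d0] := eqVneq d 0.
  rewrite pt_add_opposite // /opposite.
  have ex : x = x3 by apply/eqP; rewrite -subr_eq0 e2 d0 mul0r.
  rewrite -ex eqxx /= eqr_opp eq_sym -subr_eq0 -/n e1 d0 !mul0r //.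
set y3 := - (_ + _) in h3 *.
have ny3 : x = x3 -> n = - y3 by move=> ex; rewrite /n /y3 -ex opprK.
have nopp' : ~~ opposite x3 y3 x y.
  apply/negP => /andP[/eqP ex /eqP ey].
  have en := ny3 (esym ex).
  have : d * (y + n) = 0 by rewrite -e2 ex subrr.
  move/eqP; rewrite mulf_eq0 (negPf d0) en ey opprK /= => /eqP yy.
  by apply: (hn d0); [lra | rewrite en ey; lra].
have hl' : is_slope (d^-1 - l) x3 y3 x y.
  split.
    have -> : (d^-1 - l) * (x - x3) = (y + n) - l * (x - x3).
      by rewrite mulrBl e2; field; rewrite d0.
    by rewrite /y3 /n; ring.
  move=> ex; rewrite (chord_deriv _ _ _ _ _ _ h1 h2 hl) -/x3.
  have en := ny3 (esym ex).
  have yn : y + n = 0.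
    have /eqP : d * (y + n) = 0 by rewrite -e2 ex subrr.
    by rewrite mulf_eq0 (negPf d0) => /eqP.
  have e1' : (x3 - x1) * (x3 - x2) = 2 * y / d.
    have -> : 2 * y = y - n by rewrite -[LHS]subr0 -yn; ring.
    by rewrite e1 -ex; field; rewrite d0.
  rewrite subrr !mulr0 !addr0 -mulrA e1'.
  have -> : y1 + l * (x3 - x1) = - y3 by rewrite /y3 opprK.
  have -> : y = y3 by lra.
  by field; rewrite d0.
rewrite (pt_add_slope _ _ _ _ _ h3 h nopp' hl').
case: hl' => ey _; congr Some; rewrite -/(third _ _ _); congr pair.
by rewrite [in RHS]ey; ring.
Qed.

(* The slopes through P, Q and through R, Q determine the same divided difference
   d, so that both sides are given by pt_add_add. *)
Lemma pt_add_right_comm P Q R : on_curve p P -> on_curve p Q -> on_curve p R ->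
  pt_add p (pt_add p P Q) R = pt_add p (pt_add p R Q) P.
Proof.
move=> hP hQ hR.
have neutr S : pt_add p S None = S by case: S => [[]|].
case: P hP => [[xP yP]|] hP; last by rewrite neutr pt_addC.
case: Q hQ => [[xQ yQ]|] hQ; last by rewrite !neutr pt_addC.
case: R hR => [[xR yR]|] hR; last by rewrite neutr pt_addC //; exact: pt_addC.
have oppE x1 y1 x2 y2 : opposite x1 y1 x2 y2 -> Some (x1, y1) = pt_opp (Some (x2, y2)).
  by case/andP => /eqP-> /eqP->.
have [o1|n1] := boolP (opposite xP yP xQ yQ).
  rewrite pt_add_opposite // (oppE _ _ _ _ o1) [RHS]pt_addC; last 2 first.
  - exact: on_curve_add.
  - exact: on_curve_opp.
  by rewrite (pt_addC _ _ hR hQ) pt_addKV.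
have [o2|n2] := boolP (opposite xR yR xQ yQ).
  rewrite [pt_add p (Some (xR, yR)) _]pt_add_opposite // (oppE _ _ _ _ o2) [LHS]pt_addC;
    last 2 first.
  - exact: on_curve_add.
  - exact: on_curve_opp.
  by rewrite (pt_addC _ _ hP hQ) pt_addKV.
have [eRP|nRP] := eqVneq xR xP.
  have [o3|n3] := boolP (opposite xR yR xP yP); last first.
    by have [-> _] := non_opposite _ _ _ _ hR hP n3 eRP; rewrite eRP.
  rewrite [LHS]pt_addC //; last exact: on_curve_add.
  rewrite (oppE _ _ _ _ o3) (pt_addKV _ _ hP hQ) [RHS]pt_addC //; last first.
    by apply: on_curve_add => //; exact: on_curve_opp.
  have := pt_addKV (pt_opp (Some (xP, yP))) _ (on_curve_opp _ hP) hQ.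
  by rewrite [pt_opp (pt_opp _)]/= opprK => ->.
rewrite /on_curve in hP hQ hR.
have hl := pt_slopeP _ _ _ _ hP hQ n1; set l := pt_slope _ _ _ _ in hl.
have hl' := pt_slopeP _ _ _ _ hR hQ n2; set l' := pt_slope _ _ _ _ in hl'.
have nz : xR - xP != 0 by rewrite subr_eq0.
have [d el'] : exists d, l' = l + d * (xR - xP).
  by exists ((l' - l) / (xR - xP)); field.
have [[eP _] [eR _]] := (hl, hl').
have [[hB _] [hB' _]] := (chord_coefs _ _ _ _ _ hP hQ hl, chord_coefs _ _ _ _ _ hR hQ hl').
have e2 : xR - third l xP xQ = d * (yR + (yP + l * (xR - xP))).
  apply: (mulfI nz); apply/eqP; rewrite -subr_eq0; apply/eqP.
  rewrite -(subrr p`_1) {1}hB hB' /third el'.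
  have -> : yP = yQ - l * (xQ - xP) by rewrite eP; ring.
  have -> : yR = yQ - (l + d * (xR - xP)) * (xQ - xR) by rewrite eR el'; ring.
  ring.
have e1 : yR - (yP + l * (xR - xP)) = d * (xR - xP) * (xR - xQ).
  have -> : yP = yQ - l * (xQ - xP) by rewrite eP; ring.
  have -> : yR = yQ - (l + d * (xR - xP)) * (xQ - xR) by rewrite eR el'; ring.
  by ring.
have hn : d != 0 -> yR = 0 -> yP + l * (xR - xP) <> 0.
  move=> d0 yR0 n0; move/eqP: e1; rewrite yR0 n0 subrr eq_sym !mulf_eq0.
  rewrite (negPf d0) (negPf nz) subr_eq0 /= => /eqP eRQ.
  by have [_] := non_opposite _ _ _ _ hR hQ n2 eRQ; rewrite yR0 eqxx.
rewrite (pt_add_add _ _ _ _ _ _ _ _ hP hQ hR n1 hl e1 e2 hn).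
have e1' : yP - (yR + l' * (xP - xR)) = d * (xP - xR) * (xP - xQ).
  have -> : yP = yQ - l * (xQ - xP) by rewrite eP; ring.
  have -> : yR = yQ - (l + d * (xR - xP)) * (xQ - xR) by rewrite eR el'; ring.
  by rewrite el'; ring.
have e2' : xP - third l' xR xQ = d * (yP + (yR + l' * (xP - xR))).
  have -> : third l' xR xQ = third l xP xQ + l' ^+ 2 - l ^+ 2 + xP - xR.
    by rewrite /third; ring.
  have -> : third l xP xQ = xR - d * (yR + (yP + l * (xR - xP))) by rewrite -e2; ring.
  have -> : yP = yQ - l * (xQ - xP) by rewrite eP; ring.
  have -> : yR = yQ - (l + d * (xR - xP)) * (xQ - xR) by rewrite eR el'; ring.
  by rewrite el'; ring.
have hn' : d != 0 -> yP = 0 -> yR + l' * (xP - xR) <> 0.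
  move=> d0 yP0 n0; move/eqP: e1'; rewrite yP0 n0 subrr eq_sym !mulf_eq0.
  rewrite (negPf d0) -opprB oppr_eq0 (negPf nz) subr_eq0 /= => /eqP ePQ.
  by have [_] := non_opposite _ _ _ _ hP hQ n1 ePQ; rewrite yP0 eqxx.
rewrite (pt_add_add _ _ _ _ _ _ _ _ hR hQ hP n2 hl' e1' e2' hn').
have [//|d0] := eqVneq d 0.
have -> : third l' xR xQ = third l xP xQ + l' ^+ 2 - l ^+ 2 + xP - xR.
  by rewrite /third; ring.
have -> : third l xP xQ = l ^+ 2 - p`_2 - xP - xQ by [].
have -> : yP = yQ - l * (xQ - xP) by rewrite eP; ring.
have -> : yR = yQ - (l + d * (xR - xP)) * (xQ - xR) by rewrite eR el'; ring.
rewrite el'; congr (Some (_, _)); field; exact: d0.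
Qed.

Lemma pt_addA P Q R : on_curve p P -> on_curve p Q -> on_curve p R ->
  pt_add p P (pt_add p Q R) = pt_add p (pt_add p P Q) R.
Proof.
move=> hP hQ hR; rewrite pt_add_right_comm // pt_addC //; last exact: on_curve_add.
by rewrite (pt_addC _ _ hQ hR).
Qed.

(* The descent map x - e, to be read modulo squares; the value p'(e) at (e, 0)
   makes it multiplicative there. *)
Definition kummer (e : rat) (P : Defs.point) : rat :=
  if P is Some (x, _) then if x == e then p^`().[e] else x - e else 1.

Lemma kummer_neq0 e P : p.[e] = 0 -> kummer e P != 0.
Proof.
move=> pe; rewrite /kummer; case: P => [[x y]|] //.
have [_|ne] := eqVneq x e; first exact: nonsing.
by rewrite subr_eq0.
Qed.

(** At e, [chord_horner] says that the product of the x_i - e is n^2, with n the ordinate of the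
    line at e. If some x_i is e, then n = 0 and p'(e) is the product of the other two differences,
    so the root is p'(e). *)
Lemma kummer_add e P Q : p.[e] = 0 -> on_curve p P -> on_curve p Q ->
  exists2 k, k != 0 & kummer e (pt_add p P Q) * kummer e P * kummer e Q = k ^+ 2.
Proof.
move=> pe; have k0 S := kummer_neq0 _ S pe.
case: P => [[x1 y1]|]; last first.
  by move=> _ _; exists (kummer e Q); rewrite // mulr1 -expr2.
case: Q => [[x2 y2]|]; last first.
  by move=> _ _; exists (kummer e (Some (x1, y1))); rewrite // mulr1 -expr2.
rewrite /on_curve => h1 h2.
have [opp|nopp] := boolP (opposite x1 y1 x2 y2).
  rewrite pt_add_opposite // mul1r; exists (kummer e (Some (x1, y1))) => //.
  by case/andP: opp => /eqP-> _; rewrite -expr2.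
have hl := pt_slopeP _ _ _ _ h1 h2 nopp; set l := pt_slope _ _ _ _ in hl.
rewrite (pt_add_slope _ _ _ _ _ h1 h2 nopp hl) /kummer.
have := chord_horner _ _ _ _ _ e h1 h2 hl.
have := chord_deriv _ _ _ _ _ e h1 h2 hl.
move: (third l x1 x2) => x3; set n := y1 + _ => hd; rewrite pe sub0r => hn.
have [/eqP|nz] := boolP ((e - x1) * (e - x2) * (e - x3) == 0).
  move=> z; have n0 : n = 0 by apply/eqP; rewrite -sqrf_eq0 -oppr_eq0 hn z.
  have d0 := nonsing e pe; exists (p^`().[e]) => //.
  move: z d0 hd; rewrite n0 mulr0 add0r => /eqP; rewrite !mulf_eq0 !subr_eq0.
  case/orP => [/orP[]|] /eqP <-; rewrite eqxx subrr !(mul0r, mulr0, addr0, add0r).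
  - move=> d0 hd; move: d0; rewrite hd mulf_eq0 !subr_eq0 negb_or.
    rewrite ![e == _]eq_sym => /andP[/negPf-> /negPf->]; ring.
  - move=> d0 hd; move: d0; rewrite hd mulf_eq0 !subr_eq0 negb_or.
    rewrite ![e == _]eq_sym => /andP[/negPf-> /negPf->]; ring.
  - move=> d0 hd; move: d0; rewrite hd mulf_eq0 !subr_eq0 negb_or.
    rewrite ![e == _]eq_sym => /andP[/negPf-> /negPf->]; ring.
exists n; first by rewrite -sqrf_eq0 -oppr_eq0 hn.
move: nz; rewrite !mulf_eq0 !subr_eq0 ![e == _]eq_sym !negb_or -[n ^+ 2]opprK hn.
by case/andP => /andP[/negPf-> /negPf->] /negPf->; ring.
Qed.

Lemma pt_double_eq0 P : on_curve p P -> pt_add p P P = None ->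
  P = None \/ exists2 x, P = Some (x, 0) & p.[x] = 0.
Proof.
case: P => [[x y]|] /=; last by left.
rewrite eqxx /=; case: eqP => // yN h _; right; have y0 : y = 0 by lra.
by exists x; rewrite ?y0 // -h y0 expr0n.
Qed.

End ChordTangent.

(** * The abelian group of rational points *)

Record nonsingular_cubic := NonsingularCubic {
  cubic :> {poly rat};
  cubic_monic : cubic \is monic;
  size_cubic : size cubic = 4%N;
  cubic_nonsing : forall x, cubic.[x] = 0 -> cubic^`().[x] != 0 }.

Section Group.
Variable W : nonsingular_cubic.

Definition on_curveb (P : Defs.point) : bool :=
  if P is Some (x, y) then y ^+ 2 == W.[x] else true.

Lemma on_curveP P : reflect (on_curve W P) (on_curveb P).
Proof. by case: P => [[x y]|] /=; [exact: eqP | exact: ReflectT]. Qed.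

Record rational_point := RationalPoint {
  point_of :> option (rat * rat); point_ofP : on_curveb point_of }.

HB.instance Definition _ := [isSub for point_of].
HB.instance Definition _ := [Choice of rational_point by <:].

Lemma point_on_curve (P : rational_point) : on_curve W P.
Proof. exact/on_curveP/point_ofP. Qed.

Definition rp_zero := @RationalPoint None isT.
Definition rp_opp (P : rational_point) := @RationalPoint (pt_opp P)
  (introT (on_curveP _) (on_curve_opp W _ (point_on_curve P))).
Definition rp_add (P Q : rational_point) := @RationalPoint (pt_add W P Q)
  (introT (on_curveP _) (on_curve_add _ (cubic_monic W) (size_cubic W) _ _
    (point_on_curve P) (point_on_curve Q))).

Lemma rp_addA : associative rp_add.
Proof.
move=> P Q R; apply: val_inj => /=.
apply: pt_addA; do ?exact: point_on_curve; do ?exact: cubic_monic; do ?exact: size_cubic.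
exact: cubic_nonsing.
Qed.

Lemma rp_addC : commutative rp_add.
Proof.
move=> P Q; apply: val_inj => /=.
by apply: pt_addC; exact: point_on_curve.
Qed.

Lemma rp_add0 : left_id rp_zero rp_add.
Proof. by move=> P; apply: val_inj. Qed.

Lemma rp_addN : left_inverse rp_zero rp_opp rp_add.
Proof. by move=> P; apply: val_inj; exact: pt_addN. Qed.

HB.instance Definition _ :=
  GRing.isZmodule.Build rational_point rp_addA rp_addC rp_add0 rp_addN.

Lemma point_of_mulrz (P : rational_point) (n : int) :
  point_of (P *~ n) = pt_mulz W n P.
Proof.
have nat_case m : point_of (P *+ m) = iter m (pt_add W P) None.
  by elim: m => [|m IHm] //; rewrite mulrS iterS -IHm.
by case: n => m; rewrite /pt_mulz -nat_case.
Qed.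

Lemma point_of_sum (I : finType) (P : I -> rational_point) :
  point_of (\sum_i P i) = \big[pt_add W/None]_i point_of (P i).
Proof. by apply: (big_morph point_of) => [Q R|]. Qed.

End Group.

(** * Descent *)

(** Induction on N with all |m i| < 2^N. The hypothesis is used with e the parities and Q the
    combination of the halves; S = 0 then says that this Q doubles to zero, which is the assumption
    for the halved coefficients. *)
Lemma independent_of_parity (G : zmodType) (I : finType) (P : I -> G) :
  (forall (e : I -> bool) (Q : G), let S := Q *+ 2 + \sum_i P i *+ e i in
     S *+ 2 = 0 -> S = 0 /\ forall i, e i = false) ->
  forall n : I -> int, \sum_i P i *~ n i = 0 -> forall i, n i = 0.
Proof.
move=> key n n0.
suff main N : forall m : I -> int, (forall i, `|m i| < 2 ^+ N) ->
    (\sum_i P i *~ m i) *+ 2 = 0 -> forall i, m i = 0.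
  (* A crude exponent suffices: |n i| <= N < 2^N for N the sum of the |n i|. *)
  apply: (main (\sum_i `|n i|)%N); last by rewrite n0 mul0rn.
  move=> i; rewrite -abszE -[2 in ltRHS]/(2%:R) -natrX natz ltz_nat (leq_ltn_trans _ (ltn_expl _ _)) //.
  by rewrite (bigD1 i) //= leq_addr.
elim: N => [|N IHN] m mN m0 i.
  by have := mN i; rewrite expr0; lia.
pose h i := (m i %/ 2)%Z; pose e i := (m i %% 2)%Z != 0.
have me j : m j = h j * 2 + (e j)%:Z.
  rewrite {1}(divz_eq (m j) 2) -/(h j); congr (_ + _); rewrite /e.
  have := modz_ge0 (m j) (isT : 2 != 0 :> int); have := ltz_pmod (m j) (isT : 0 < 2 :> int).
  by case: eqP; lia.
have eS : \sum_j P j *~ m j = (\sum_j P j *~ h j) *+ 2 + \sum_j P j *+ e j.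
  rewrite -sumrMnl -big_split /=; apply: eq_bigr => j _.
  by rewrite {1}me mulrzDr mulrzA.
have [] := key e (\sum_j P j *~ h j); rewrite -eS // => S0 e0.
have em j : m j = h j * 2 by rewrite me e0 addr0.
suff h0 : h i = 0 by rewrite em h0 mul0r.
apply: IHN => [j|].
  by have := mN j; rewrite em exprSr; move: (2 ^+ N) (h j) => B x; lia.
by rewrite -{2}S0 -sumrMnl; apply: eq_bigr => j _; rewrite em mulrzA.
Qed.

(** * Rational numbers modulo squares *)

Definition nzsquare (x : rat) : Prop := exists2 k, k != 0 & x = k ^+ 2.

Lemma nzsquare_gt0 x : nzsquare x -> 0 < x.
Proof. by case=> k k0 ->; rewrite lt0r sqrf_eq0 k0 sqr_ge0. Qed.

Lemma nzsquare_scale k x y : k != 0 -> k ^+ 2 * x = y -> nzsquare y -> nzsquare x.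
Proof.
move=> k0 <- [l l0 e]; exists (l / k); first by rewrite mulf_neq0 ?invr_eq0.
by rewrite expr_div_n -e; field.
Qed.

Lemma nzsquareM x y : nzsquare x -> nzsquare y -> nzsquare (x * y).
Proof.
by move=> [k k0 ->] [l l0 ->]; exists (k * l); rewrite ?mulf_neq0 // exprMn.
Qed.

Section Kummer.
Variables (W : nonsingular_cubic) (e : rat).
Hypothesis We : W.[e] = 0.
Notation kap := (kummer W e).

(** That y z is a nonzero square expresses that y and z have the same class. Here x accumulates the
    classes of the summands so far, and Q is the next one. *)
Lemma kummer_rel (P Q : rational_point W) (x : rat) :
  nzsquare (kap P * x) -> nzsquare (kap (P + Q) * (x * kap Q)).
Proof.
move=> hx; have [k k0 ek] := kummer_add W (cubic_monic W) (size_cubic W)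
  (cubic_nonsing W) e P Q We (point_on_curve W P) (point_on_curve W Q).
have kP := kummer_neq0 W (cubic_nonsing W) e P We.
have hk : nzsquare (kap (P + Q) * kap P * kap Q) by exists k.
by apply: nzsquare_scale kP _ (nzsquareM _ _ hx hk); ring.
Qed.

Lemma kummer_double (Q : rational_point W) : nzsquare (kap (Q *+ 2) * 1).
Proof.
have kQ := kummer_neq0 W (cubic_nonsing W) e Q We.
apply: (nzsquare_scale (kap Q) _ (kap (Q + Q) * (kap Q * kap Q)) kQ).
  by rewrite mulr2n; ring.
by apply: kummer_rel; exists (kap Q).
Qed.

Lemma kummer_parity n (P : 'I_n -> rational_point W) (b : 'I_n -> bool) (Q : rational_point W) :
  nzsquare (kap (Q *+ 2 + \sum_i P i *+ b i) * \prod_i kap (P i) ^+ b i).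
Proof.
elim: n P b => [|n IHn] P b; first by rewrite !big_ord0 addr0; exact: kummer_double.
rewrite !big_ord_recr addrA.
have IH := IHn (fun i => P (widen_ord (leqnSn n) i)) (fun i => b (widen_ord (leqnSn n) i)).
case: (b ord_max); first exact: kummer_rel.
by rewrite mulr0n addr0 expr0 Monoid.mulm1.
Qed.

End Kummer.

(** * Non-squares along the family *)

Lemma denominator_neq0 (t : rat) : t ^+ 2 - 10 != 0.
Proof.
rewrite subr_eq0; apply/eqP => e; have [m em] := rat_square_int t 10 e.
by apply: (nonsquare_2mod8 1 m); rewrite -em.
Qed.

Lemma paramE (t : rat) : param t * (t ^+ 2 - 10) = - 16 * t.
Proof. by have := denominator_neq0 t; rewrite /param addrC => h; field. Qed.

Lemma nonsquare2 : ~ nzsquare 2.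
Proof.
case=> k _ /esym e; have [m em] := rat_square_int k 2 e.
by apply: (nonsquare_2mod8 0 m); rewrite -em.
Qed.

Section Triples.
Variables t u : rat.
Hypotheses (t0 : t != 0) (tu : u * (t ^+ 2 - 10) = - 16 * t).
Let a := u ^+ 2 + 32.
Let D := 2 * a ^+ 2 + 256 * u ^+ 2.

Lemma u_neq0 : u != 0.
Proof.
by apply/eqP => u0; case/eqP: t0; move: tu; rewrite u0 mul0r; lra.
Qed.

Lemma aE : a * (t ^+ 2 - 10) ^+ 2 = 32 * (t ^+ 4 - 12 * t ^+ 2 + 100).
Proof.
have -> : a * (t ^+ 2 - 10) ^+ 2 = (u * (t ^+ 2 - 10)) ^+ 2 + 32 * (t ^+ 2 - 10) ^+ 2.
  by rewrite /a; ring.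
by rewrite tu; ring.
Qed.

Lemma nonsquare_a : ~ nzsquare a.
Proof.
case=> k _ e; apply: (two_quartic_nonsquare (- 3) 12 t (k * (t ^+ 2 - 10) / 4)).
have -> : (k * (t ^+ 2 - 10) / 4) ^+ 2 = a * (t ^+ 2 - 10) ^+ 2 / 16 by rewrite e; field.
by rewrite aE; field.
Qed.

Lemma nonsquare_2a : ~ nzsquare (2 * a).
Proof.
case=> k _ e; case/eqP: t0; apply: (rat_quartic_m12_100 t (k * (t ^+ 2 - 10) / 8)).
have -> : (k * (t ^+ 2 - 10) / 8) ^+ 2 = 2 * (a * (t ^+ 2 - 10) ^+ 2) / 64.
  by rewrite mulrA e; field.
by rewrite aE; field.
Qed.

Lemma nonsquare_D : ~ nzsquare D.
Proof.
case=> k _ e; apply: (two_quartic_nonsquare 3 0 (u / 4) (k / 16)).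
have -> : (k / 16) ^+ 2 = D / 256 by rewrite e; field.
by rewrite /D /a; field.
Qed.

Lemma nonsquare_2D : ~ nzsquare (2 * D).
Proof.
case=> k _ e; have := u_neq0.
have /eqP : u / 4 = 0.
  apply: (rat_quartic12_4 _ (k / 32)).
  have -> : (k / 32) ^+ 2 = 2 * D / 1024 by rewrite e; field.
  by rewrite /D /a; field.
by rewrite mulf_eq0 invr_eq0 orbF => ->.
Qed.

Lemma a_gt0 : 0 < a.
Proof. by rewrite /a; have := sqr_ge0 u; lra. Qed.

End Triples.

(** * Smoothness of the curves *)

Lemma deriv_factored (F : fieldType) (al be x : F) :
  ('X * ('X + al%:P) * ('X - be%:P))^`().[x] = (2 * x + al) * (x - be) + x * (x + al).
Proof. by rewrite !derivM !derivD !derivN !derivC !derivX !hornerE; ring. Qed.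

(** Over any field, because it serves twice: over Q for the group law and over [algC] for
    [elliptic]. *)
Lemma nonsingular_factored (F : fieldType) (al be x : F)
    (p := 'X * ('X + al%:P) * ('X - be%:P)) :
  al != 0 -> be != 0 -> al + be != 0 -> p.[x] = 0 -> p^`().[x] != 0.
Proof.
move=> al0 be0 ab0.
rewrite /p deriv_factored !hornerE => /eqP; rewrite !mulf_eq0 -orbA => /or3P[/eqP->|/eqP e|/eqP e].
- by rewrite !(mul0r, mulr0, addr0, add0r, sub0r) mulf_neq0 ?oppr_eq0.
- have -> : x = - al by apply/eqP; rewrite -addr_eq0 e.
  have -> : (2 * - al + al) * (- al - be) + - al * (- al + al) = al * (al + be) by ring.
  by rewrite mulf_neq0.
have -> : x = be by apply/eqP; rewrite -subr_eq0 e.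
have -> : (2 * be + al) * (be - be) + be * (be + al) = be * (al + be) by ring.
by rewrite mulf_neq0.
Qed.

Section Cubic.
Variables a b c : rat.
Hypotheses (a0 : a != 0) (b0 : b != 0).

Lemma sum_squares_neq0 : 2 * a ^+ 2 + b ^+ 2 != 0.
Proof.
have sq_gt0 (x : rat) : x != 0 -> 0 < x ^+ 2 by move=> x0; rewrite lt0r sqrf_eq0 x0 sqr_ge0.
by rewrite lt0r_neq0 // addr_gt0 ?sq_gt0 // pmulr_rgt0 // sq_gt0.
Qed.

Lemma E_monic : E a b c \is monic.
Proof. 
rewrite /E monicMr ?monicXsubC // monicMl ?monicX //; exact: monicXaddC. Qed.

Lemma size_E : size (E a b c) = 4%N.
Proof.
have mX : 'X + (2 * a ^+ 2)%:P \is monic := monicXaddC _.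
have mXX : 'X * ('X + (2 * a ^+ 2)%:P) \is monic by rewrite monicMl ?monicX.
rewrite /E (size_monicM mXX) ?polyXsubC_eq0 // size_XsubC.
by rewrite (size_monicM (monicX _)) ?monic_neq0 // size_polyX size_XaddC.
Qed.

Lemma E_nonsing x : (E a b c).[x] = 0 -> (E a b c)^`().[x] != 0.
Proof.
by apply: nonsingular_factored; rewrite ?sum_squares_neq0 ?mulf_neq0 ?sqrf_eq0.
Qed.

Lemma E_elliptic : elliptic (E a b c).
Proof.
split; [exact: E_monic | exact: size_E | move=> x y e [y0 d0]].
have {}y0 : y = 0 by move/eqP: y0; rewrite mulf_eq0 pnatr_eq0 /= => /eqP.
have eE : map_poly ratr (E a b c) =
  'X * ('X + (ratr (2 * a ^+ 2) : algC)%:P) * ('X - (ratr (b ^+ 2))%:P).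
  by rewrite /E rmorphM rmorphM rmorphD rmorphB /= map_polyX !map_polyC.
move: e d0; rewrite y0 expr0n eE => /esym e /eqP; apply/negP.
by apply: nonsingular_factored; rewrite -?rmorphD ?fmorph_eq0 ?sum_squares_neq0 ?mulf_neq0 ?sqrf_eq0.
Qed.

Definition E_cubic := NonsingularCubic _ E_monic size_E E_nonsing.

End Cubic.

(** * Independence of the three points *)

Lemma square_class_trivial (a s : rat) (e0 e1 e2 : bool) :
  0 < a -> ~ nzsquare 2 -> ~ nzsquare a -> ~ nzsquare (2 * a) ->
  s = 1 \/ s = - 2 ->
  nzsquare (s * ((- 2) ^+ e0 * (2 ^+ e1 * (2 * a) ^+ e2))) ->
  [/\ e0 = (s == - 2), e1 = false & e2 = false].
Proof.
move=> a0 n2 na n2a hs h; have h0 := nzsquare_gt0 _ h.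
have sc (k x y : rat) : k != 0 -> nzsquare y -> k ^+ 2 * x = y -> nzsquare x.
  by move=> k0 hy e; exact: nzsquare_scale k0 e hy.
(* As a > 0, the sign determines e0; what remains is 1, 2, 2a or 4a, times 4 when s = -2. The
   arguments 1, 2, 4 of [sc] are the roots of the square factors. *)
case: hs e0 e1 e2 h h0 => -> [] [] []; rewrite ?expr1 ?expr0 ?eqxx => h h0;
  first [by split | exfalso; first [by move: h0; lra
    | by apply: n2; apply: (sc 1 _ _ _ h) => //; ring
    | by apply: n2; apply: (sc 2 _ _ _ h) => //; ring
    | by apply: na; apply: (sc 2 _ _ _ h) => //; ring
    | by apply: na; apply: (sc 4 _ _ _ h) => //; ring
    | by apply: n2a; apply: (sc 1 _ _ _ h) => //; ring
    | by apply: n2a; apply: (sc 2 _ _ _ h) => //; ring]].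
Qed.

Section Main.
Variables a b c u w : rat.
Hypotheses (ea : a = u ^+ 2 + 32) (eb : b = - 16 * u) (ec : c = 32 - u ^+ 2).
Hypotheses (ew : w ^+ 2 = 10 * u ^+ 2 + 64) (u0 : u != 0) (c0 : c != 0) (w0 : w != 0).
Hypotheses (apos : 0 < a) (b0 : b != 0).
Hypotheses (n2 : ~ nzsquare 2) (na : ~ nzsquare a) (n2a : ~ nzsquare (2 * a)).
Hypotheses (nD : ~ nzsquare (2 * a ^+ 2 + b ^+ 2)).
Hypotheses (n2D : ~ nzsquare (2 * (2 * a ^+ 2 + b ^+ 2))).

Let a0 : a != 0 := lt0r_neq0 apos.
Notation Wc := (E_cubic a b c a0 b0).

Let hornerW x : (E a b c).[x] = x * (x + 2 * a ^+ 2) * (x - b ^+ 2).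
Proof. by rewrite /E !hornerE. Qed.

Let derivW x : (E a b c)^`().[x] = (2 * x + 2 * a ^+ 2) * (x - b ^+ 2) + x * (x + 2 * a ^+ 2).
Proof. exact: deriv_factored. Qed.

(** The factors x, x + 2a^2, x - b^2 are -2c^2, b^2, -2a^2 at the first point, 2a^2, 4a^2, 2c^2 at
    the second, and 2a (2u)^2, a w^2, 8u^4 at the third. *)
Let on1 : on_curveb Wc (Some (- 2 * c ^+ 2, 2 * a * b * c)).
Proof. by apply/eqP; rewrite /= hornerW ea eb ec; ring. Qed.

Let on2 : on_curveb Wc (Some (2 * a ^+ 2, 4 * a ^+ 2 * c)).
Proof. by apply/eqP; rewrite /= hornerW ea eb ec; ring. Qed.

Let on3 : on_curveb Wc (Some (8 * u ^+ 2 * a, 8 * u ^+ 3 * a * w)).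
Proof.
apply/eqP; rewrite /= hornerW.
have -> : (8 * u ^+ 3 * a * w) ^+ 2 = 64 * u ^+ 6 * a ^+ 2 * w ^+ 2 by ring.
by rewrite ew ea eb; ring.
Qed.

Let pts (i : 'I_3) : rational_point Wc :=
  tnth [tuple @RationalPoint Wc _ on1; @RationalPoint Wc _ on2; @RationalPoint Wc _ on3] i.

Let kummerE e x y : x != e -> kummer Wc e (Some (x, y)) = x - e.
Proof. by rewrite /kummer => /negPf->. Qed.

Let kummer_prod e (eps : 'I_3 -> bool) :
  - 2 * c ^+ 2 != e -> 2 * a ^+ 2 != e -> 8 * u ^+ 2 * a != e ->
  \prod_i kummer Wc e (pts i) ^+ eps i =
    (- 2 * c ^+ 2 - e) ^+ eps 0 * ((2 * a ^+ 2 - e) ^+ eps 1 * (8 * u ^+ 2 * a - e) ^+ eps 2).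
Proof.
move=> h1 h2 h3; rewrite !big_ord_recl big_ord0 mulr1.
have -> : lift ord0 ord0 = 1 :> 'I_3 by apply: val_inj.
have -> : lift ord0 (lift ord0 ord0) = 2 :> 'I_3 by apply: val_inj.
rewrite -(kummerE _ _ (2 * a * b * c) h1) -(kummerE _ _ (4 * a ^+ 2 * c) h2).
by rewrite -(kummerE _ _ (8 * u ^+ 3 * a * w) h3).
Qed.

Let eb2 : b ^+ 2 = 2 * a ^+ 2 - 2 * c ^+ 2.
Proof. by rewrite ea eb ec; ring. Qed.

Let nzM2 (x y : rat) : x != 0 -> y != 0 -> x * y ^+ 2 != 0.
Proof. by move=> x0 y0; rewrite mulf_neq0 ?sqrf_eq0. Qed.

Let rel0 (eps : 'I_3 -> bool) (s k kap : rat) : k != 0 -> kap = s * k ^+ 2 ->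
  nzsquare (kap * \prod_i kummer Wc 0 (pts i) ^+ eps i) ->
  nzsquare (s * ((- 2) ^+ eps 0 * (2 ^+ eps 1 * (2 * a) ^+ eps 2))).
Proof.
have h1 : - 2 * c ^+ 2 != 0 by exact: nzM2.
have h2 : 2 * a ^+ 2 != 0 by exact: nzM2.
have h3 : 8 * u ^+ 2 * a != 0 by rewrite mulf_neq0 // nzM2.
move=> k0 ->; rewrite (kummer_prod _ _ h1 h2 h3) => h.
apply: (nzsquare_scale (k * (c ^+ eps 0 * (a ^+ eps 1 * (2 * u) ^+ eps 2))) _ _ _ _ h).
  by rewrite !mulf_neq0 ?expf_neq0 ?mulf_neq0.
by case: (eps 0) (eps 1) (eps 2) => [] [] []; rewrite ?expr1 ?expr0; ring.
Qed.

(** Only the first point can still contribute, and its value at the root -2a^2 is the square b^2, so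
    s alone must be a square whatever [eps 0] is. *)
Let rel1 (eps : 'I_3 -> bool) (s k kap : rat) : k != 0 -> kap = s * k ^+ 2 ->
  eps 1 = false -> eps 2 = false ->
  nzsquare (kap * \prod_i kummer Wc (- 2 * a ^+ 2) (pts i) ^+ eps i) -> nzsquare s.
Proof.
move=> k0 -> e1 e2; rewrite kummer_prod.
- rewrite e1 e2 !expr0 !mulr1 => h.
  apply: (nzsquare_scale (k * b ^+ eps 0) _ _ _ _ h).
    by rewrite mulf_neq0 ?expf_neq0.
  have -> : - 2 * c ^+ 2 - - 2 * a ^+ 2 = b ^+ 2 by rewrite eb2; ring.
  by case: (eps 0); rewrite ?expr1 ?expr0; ring.
- rewrite -subr_eq0; have -> : - 2 * c ^+ 2 - - 2 * a ^+ 2 = b ^+ 2 by rewrite eb2; ring.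
  by rewrite sqrf_eq0.
- rewrite -subr_eq0; have -> : 2 * a ^+ 2 - - 2 * a ^+ 2 = 4 * a ^+ 2 by ring.
  by rewrite nzM2.
- rewrite -subr_eq0.
  have -> : 8 * u ^+ 2 * a - - 2 * a ^+ 2 = a * w ^+ 2 by rewrite ew ea; ring.
  by rewrite nzM2.
Qed.

Lemma rank_at_least3 : rank_at_least (E a b c) 3.
Proof.
exists (fun i => point_of _ (pts i)); split=> [i|n n0]; first exact: point_on_curve.
have {n0} : \sum_i pts i *~ n i = 0.
  apply: val_inj; rewrite /= point_of_sum -[RHS]n0; apply: eq_bigr => i _.
  exact: point_of_mulrz.
apply: independent_of_parity => eps Q S S2.
have r0 : Wc.[0] = 0 by rewrite hornerW; ring.
have r1 : Wc.[- 2 * a ^+ 2] = 0 by rewrite hornerW; ring.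
have K0 := kummer_parity Wc 0 r0 3 pts eps Q.
have K1 := kummer_parity Wc (- 2 * a ^+ 2) r1 3 pts eps Q.
rewrite -/S in K0 K1.
have tors : point_of _ S = None \/ exists2 x, point_of _ S = Some (x, 0) & Wc.[x] = 0.
  apply: pt_double_eq0 (point_on_curve _ S) _.
  by move/(congr1 (@point_of _)): S2; rewrite mulr2n.
have a20 : - 2 * a ^+ 2 != 0 by rewrite nzM2.
have conclude s : s = 1 \/ s = - 2 ->
    nzsquare (s * ((- 2) ^+ eps 0 * (2 ^+ eps 1 * (2 * a) ^+ eps 2))) ->
    [/\ eps 0 = (s == - 2), eps 1 = false & eps 2 = false].
  by move=> hs; apply: square_class_trivial.
case: tors => [SO|[x Sx]].
  have [||e0 e1 e2] := conclude 1; first by left.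
    by apply: (rel0 _ 1 1 _ _ _ K0); rewrite ?oner_neq0 // SO /=; ring.
  split; first exact: val_inj.
  case=> -[|[|[|//]]] hi.
  - by have -> : Ordinal hi = 0 by [exact: val_inj]; rewrite e0; apply/eqP; lra.
  - by have -> : Ordinal hi = 1 by exact: val_inj.
  - by have -> : Ordinal hi = 2 by exact: val_inj.
rewrite hornerW => /eqP; rewrite !mulf_eq0 -orbA !subr_eq0 addr_eq0 -mulNr.
rewrite /kummer Sx in K0 K1; case/or3P => /eqP ex; exfalso.
- rewrite ex eqxx [0 == _]eq_sym (negPf a20) in K0 K1.
  have [||_ e1 e2] := conclude (- 2); first by right.
    (* At the root 0 the derivative is -2 (a b)^2. *)
    apply: (rel0 _ _ (a * b) _ _ _ K0); first by rewrite mulf_neq0.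
    by rewrite derivW; ring.
  by apply: n2; apply: (rel1 eps 2 a _ a0 _ e1 e2 K1); ring.
- rewrite ex eqxx (negPf a20) in K0 K1.
  have [||_ e1 e2] := conclude (- 2); first by right.
    by apply: (rel0 _ _ a _ _ _ K0) => //; ring.
  by apply: n2D; apply: (rel1 eps _ a _ a0 _ e1 e2 K1); rewrite derivW; ring.
have b20 : b ^+ 2 != 0 by rewrite sqrf_eq0.
have b2a : b ^+ 2 != - 2 * a ^+ 2.
  by rewrite -subr_eq0 mulNr opprK addrC; exact: sum_squares_neq0.
rewrite ex (negPf b20) (negPf b2a) in K0 K1.
have [||_ e1 e2] := conclude 1; first by left.
  by apply: (rel0 _ _ b _ _ _ K0) => //; ring.
by apply: nD; apply: (rel1 eps _ 1 _ _ _ e1 e2 K1) => //; ring.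
Qed.

End Main.

Theorem corollary3p3 :
  exists S0 : set (rat * rat * rat),
    [/\ finite_set S0, S0 `<=` triples &
        forall a b c : rat, (triples `\` S0) (a, b, c) ->
          elliptic (E a b c) /\ rank_at_least (E a b c) 3].
Proof.
exists set0; split=> [|//|a b c [[t t0 [ea eb ec]] _]]; first exact: finite_set0.
have tu := paramE t; have d0 := denominator_neq0 t.
move: (param t) tu ea eb ec => u tu.
rewrite /f1 /g1 /h1 !hornerE => ea eb ec.
have {}ea : a = u ^+ 2 + 32 by rewrite -ea; ring.
have {}eb : b = - 16 * u by rewrite -eb; ring.
have {}ec : c = 32 - u ^+ 2 by rewrite -ec; ring.
have u0 := u_neq0 t u t0 tu.
have b0 : b != 0 by rewrite eb mulf_neq0.
have apos : 0 < a by rewrite ea; exact: a_gt0.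
have a0 := lt0r_neq0 apos.
split; first exact: E_elliptic.
have c0 : c != 0.
  (* u^2 = 32 would make 2 the square of u / 4. *)
  rewrite ec subr_eq0; apply/eqP => e; apply: nonsquare2; exists (u / 4).
    by rewrite mulf_neq0 // invr_eq0.
  by rewrite expr_div_n -e; field.
pose w := 8 * (t ^+ 2 + 10) / (t ^+ 2 - 10).
have eu : u = - 16 * t / (t ^+ 2 - 10) by rewrite -tu mulfK.
have ew : w ^+ 2 = 10 * u ^+ 2 + 64 by rewrite /w eu; field.
have w0 : w != 0.
  by rewrite /w !mulf_neq0 ?invr_eq0 // lt0r_neq0 // ltr_wpDl ?sqr_ge0.
have eb2 : b ^+ 2 = 256 * u ^+ 2 by rewrite eb; ring.
have na := nonsquare_a t u tu; have n2a := nonsquare_2a t u t0 tu.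
have nD := nonsquare_D u; have n2D := nonsquare_2D t u t0 tu.
rewrite -ea -eb2 in na n2a nD n2D.
exact (rank_at_least3 a b c u w ea eb ec ew u0 c0 w0 apos b0 nonsquare2 na n2a nD n2D).
Qed.
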